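(* Let $G$ be a graph with maximum degree $\Delta(G)\le 3$. Then $F(G)=3$ if and only if $G$ is a graph of $3$-parallel paths. In particular, if $G$ is a graph of $3$-parallel paths with $\Delta(G)\le 3$, then the left-most vertices of the three parallel paths in any standard drawing of $G$ (as a graph of $3$-parallel paths) form a forcing set of $G$ of cardinality $F(G)$.
   Context: Graphs are finite, simple and undirected. Forcing process: starting from a set $F\subseteq V(G)$ of colored vertices (all others non-colored), at each step every colored vertex with exactly one non-colored neighbor forces that neighbor to become colored; this is iterated until nothing changes. $F$ is a forcing set of $G$ if all vertices eventually become colored. The forcing number $F(G)$ is the minimum cardinality of a forcing set of $G$. Graphs of $k$-parallel paths: a graph of $1$-parallel paths is a path. For $k\ge 2$, a graph $G$ is a graph of $k$-parallel paths if it is not a graph of $j$-parallel paths for any $1\le j<k$, and there exist $k$ vertex-disjoint induced paths of $G$ covering all vertices of $G$ such that $G$ can be drawn in the plane so that these $k$ paths lie along $k$ distinct parallel horizontal lines (each path drawn horizontally, consecutive vertices joined by horizontal segments; a one-vertex path is a single point), every edge with ends in different paths is drawn as a straight line segment (not passing through vertices other than its ends), and no two such segments cross each other. Segments are allowed to cross the horizontal paths. Such a drawing is called a standard drawing of $G$, and the $k$ paths are called its parallel paths. *)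

(* Defs.v *)
From HB Require Import structures.
From mathcomp Require Import all_boot all_order all_algebra.
From mathcomp Require Import reals.
Set Implicit Arguments.
Unset Strict Implicit.
Unset Printing Implicit Defensive.
Import Order.TTheory GRing.Theory Num.Theory.

(* A finite simple graph is a symmetric irreflexive relation e on a finType. *)

Definition max_degree (T : finType) (e : rel T) : nat :=
  \max_(v : T) #|[set u | e v u]|.

Section Forcing.
Variables (T : finType) (e : rel T).
Implicit Types (S F : {set T}) (u v : T).

Definition uncolored_nbrs S u : {set T} := [set w | e u w & w \notin S].

(* All the forces available at a given time are performed simultaneously. *)
Definition forcing_step S : {set T} :=
  S :|: [set v | [exists u in S, uncolored_nbrs S u == [set v]]].

(* #|T| rounds suffice for the process to become stationary: see forcing_setP. *)
Definition forcing_set F : bool := iter #|T| forcing_step F == [set: T].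

Lemma sub_forcing_step S : S \subset forcing_step S.
Proof. exact: subsetUl. Qed.

Lemma forcing_iter_stable F n : #|T| <= n ->
  iter n forcing_step F = iter #|T| forcing_step F.
Proof.
have stab m : forcing_step (iter m forcing_step F) = iter m forcing_step F ->
    forall d, iter (d + m) forcing_step F = iter m forcing_step F.
  by move=> Hm; elim=> [//|d IHd]; rewrite addSn iterS IHd.
have prog m : m <= #|iter m forcing_step F| \/
    forcing_step (iter m forcing_step F) = iter m forcing_step F.
  elim: m => [|m [IHm|IHm]]; [by left | | by right; rewrite iterS IHm].
  have [/eqP eqm|neqm] :=
    boolP (iter m forcing_step F == forcing_step (iter m forcing_step F)).
    by right; rewrite iterS -!eqm.
  left; rewrite iterS; apply: leq_ltn_trans IHm _; apply: proper_card.
  by rewrite properEneq neqm sub_forcing_step.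
have fixT : forcing_step (iter #|T| forcing_step F) = iter #|T| forcing_step F.
  have [leT|//] := prog #|T|; apply/eqP; rewrite eqEsubset sub_forcing_step andbT.
  suff -> : iter #|T| forcing_step F = setT by apply: subsetT.
  by apply/eqP; rewrite eqEcard subsetT cardsT.
by move=> /subnK <-; apply: stab.
Qed.

Lemma forcing_setP F :
  reflect (exists n, iter n forcing_step F = [set: T]) (forcing_set F).
Proof.
apply: (iffP eqP) => [|[n Hn]]; first by exists #|T|.
rewrite -(@forcing_iter_stable F (#|T| + n)) ?leq_addr // iterD Hn.
elim: #|T| => [//|m IHm]; rewrite iterS IHm.
by apply/eqP; rewrite eqEsubset subsetT sub_forcing_step.
Qed.

Lemma forcing_setT : forcing_set [set: T].
Proof. by apply/forcing_setP; exists 0. Qed.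

Definition forcing_number : nat :=
  #|[arg min_(F < [set: T] | forcing_set F) #|F|]|.

Lemma forcing_numberP :
  (exists2 F, forcing_set F & #|F| = forcing_number) /\
  (forall F, forcing_set F -> forcing_number <= #|F|).
Proof.
rewrite /forcing_number; case: arg_minnP => [|F forcF minF].
  exact: forcing_setT.
by split=> //; exists F.
Qed.

End Forcing.

Local Open Scope ring_scope.

Definition on_segment (R : realType) (q a b : R * R) : Prop :=
  exists2 t : R, 0 <= t <= 1 &
    q = ((1 - t) * a.1 + t * b.1, (1 - t) * a.2 + t * b.2).

(* A path is given by the sequence of its vertices, from one end to the other. *)
Definition induced_path (T : finType) (e : rel T) (p : seq T) : Prop :=
  [/\ p != [::], uniq p &
      {in p &, forall u v, e u v =
         ((index u p).+1 == index v p) || ((index v p).+1 == index u p)}].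

Definition path_graph (T : finType) (e : rel T) : Prop :=
  exists2 p : seq T, induced_path e p & forall v, v \in p.

Section ParallelPaths.
Variables (R : realType) (T : finType) (e : rel T).

Definition cross_edge (k : nat) (P : 'I_k -> seq T) (u v : T) : bool :=
  e u v && ~~ [exists i, (u \in P i) && (v \in P i)].

(* Each P i lists its path from left to right (sd_horizontal); pos v is the   *)
(* point of the plane representing v.                                         *)
Record standard_drawing (k : nat) (P : 'I_k -> seq T) (pos : T -> R * R) :
    Prop := StandardDrawing {
  sd_induced : forall i, induced_path e (P i);
  sd_disjoint : forall i j v, v \in P i -> v \in P j -> i = j;
  sd_cover : forall v, exists i, v \in P i;
  sd_lines : exists2 h : 'I_k -> R,
    injective h & forall i v, v \in P i -> (pos v).2 = h i;
  sd_horizontal : forall i, sorted (fun u v => (pos u).1 < (pos v).1) (P i);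
  sd_avoid : forall u v w,
    cross_edge P u v -> on_segment (pos w) (pos u) (pos v) -> w \in [set u; v];
  (* two distinct segments may only meet at a common end *)
  sd_noncrossing : forall u v u' v',
    cross_edge P u v -> cross_edge P u' v' -> [set u; v] != [set u'; v'] ->
    forall q, on_segment q (pos u) (pos v) -> on_segment q (pos u') (pos v') ->
    exists2 w, w \in [set u; v] :&: [set u'; v'] & q = pos w }.

Definition has_standard_drawing (k : nat) : Prop :=
  exists (P : 'I_k -> seq T) (pos : T -> R * R), standard_drawing P pos.

Definition leftmost_vertices (k : nat) (P : 'I_k -> seq T) (pos : T -> R * R) :
    {set T} :=
  [set v | [exists i, (v \in P i) && all (fun w => (pos v).1 <= (pos w).1) (P i)]].

(* The definition is recursive in k; fewer_parallel_paths k means that the    *)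
(* graph is a graph of j-parallel paths for some 1 <= j < k. The recursion    *)
(* equation is graph_of_parallel_pathsE.                                      *)
Definition parallel_paths_body (k : nat) (fewer : Prop) : Prop :=
  match k with
  | 0 => False
  | 1 => path_graph e
  | _ => ~ fewer /\ has_standard_drawing k
  end.

Fixpoint fewer_parallel_paths (k : nat) : Prop :=
  if k is j.+1
  then fewer_parallel_paths j \/ parallel_paths_body j (fewer_parallel_paths j)
  else False.

Definition graph_of_parallel_paths (k : nat) : Prop :=
  parallel_paths_body k (fewer_parallel_paths k).

Lemma fewer_parallel_pathsP k :
  fewer_parallel_paths k <->
  exists2 j, (1 <= j < k)%N & graph_of_parallel_paths j.
Proof.
elim: k => [|k IHk] /=; first by split=> // -[j]; rewrite ltn0 andbF.
split=> [[/IHk[j /andP[j1 jk] Gj]|Gk]|[j /andP[j1]]].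
- by exists j => //; rewrite j1 ltnW.
- by exists k => //; rewrite ltnSn andbT; case: k {IHk} Gk.
- rewrite ltnS leq_eqVlt => /orP[/eqP -> Gk|jk Gj]; first by right.
  by left; apply/IHk; exists j => //; rewrite j1.
Qed.

Lemma graph_of_parallel_pathsE k : (2 <= k)%N ->
  graph_of_parallel_paths k <->
  (forall j, (1 <= j < k)%N -> ~ graph_of_parallel_paths j) /\
  has_standard_drawing k.
Proof.
move=> k2; have -> : graph_of_parallel_paths k =
    (~ fewer_parallel_paths k /\ has_standard_drawing k) by case: k k2 => [|[]].
split=> -[nf sd]; split=> //.
- by move=> j jk Gj; apply: nf; apply/fewer_parallel_pathsP; exists j.
- by move=> /fewer_parallel_pathsP[j jk Gj]; apply: (nf j).
Qed.

End ParallelPaths.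

(* Main.v *)
(* A forcing process splits G into chains of successive forces, which are     *)
(* induced paths. Call a vertex active from the time it becomes coloured to   *)
(* the time it forces: the ends of an edge joining two chains are active      *)
(* simultaneously, so that if the chains are drawn on parallel lines in the   *)
(* order of time, then the edges between two given lines do not cross.        *)
(* With three chains, the remaining obstruction is an edge between the outer  *)
(* chains that has to pass on both sides of a vertex v of the middle chain;   *)
(* v then has neighbours in the outer chains that are not active at the same  *)
(* time. If v is inside its chain this contradicts the bound 3 on its degree. *)
(* If v is the first vertex of its chain, then some neighbour x of v in       *)
(* another chain forces before v does; letting the first such x force v, and  *)
(* colouring initially the vertex that x used to force, makes the middle      *)
(* chain longer. If v is the last vertex, reverse time. Hence there is no     *)
(* obstruction when the middle chain is as long as possible.                  *)
(* Conversely, suppose that in a standard drawing the colouring, started from *)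
(* the left, is stuck with an initial part of each path coloured: the last    *)
(* coloured vertex of every unfinished path has a noncoloured neighbour in    *)
(* another unfinished path. This yields a cycle of two or three paths, and    *)
(* the corresponding edges would have to cross.                               *)

Require Import Defs.
From HB Require Import structures.
From mathcomp Require Import all_boot all_order all_algebra.
From mathcomp Require Import reals.
From mathcomp Require Import zify ring lra.
Set Implicit Arguments.
Unset Strict Implicit.
Unset Printing Implicit Defensive.
Import Order.TTheory GRing.Theory Num.Theory.

(** * Forcing sets *)

Section Forcing.
Variables (T : finType) (e : rel T).
Implicit Types (S F : {set T}) (u v w : T).

(** A forcing process from k vertices, performed one force at a time, is recorded as a [timeline]
    with k labels ([forcing_set_timeline]), whose chains are induced paths ([chain_induced]). For k
    = 1 this exhibits a path. For k = 2 the edges between the chains are consistently ordered by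
    time ([parallel_edges]), which gives a drawing. For k = 3, [timeline_maximal] provides a
    timeline in which rerouting cannot lengthen the middle chain; with degrees at most 3, the outer
    neighbours of a middle vertex then have pairwise overlapping activity ([timeline_cross_nbrs]).
    Hence the outer edges that must pass to the left of a middle vertex form an initial part of all
    outer edges, and this part can be separated from the rest by an explicit [abscissa];
    [rising_segments] shows that segments meet only at common ends. Conversely, on at most 3 lines
    the leftmost vertices always force ([leftmost_vertices_forcing]): a stuck colouring yields a
    cycle of blocked paths, excluded by [blocked_pair] and [blocked_cycle]. So a drawing on k lines,
    k at most 3, bounds the forcing number by k, while forcing number 1 or 2 gives a drawing on that
    many lines. The equivalence and the minimality of the leftmost vertices follow. *)

Lemma forcing_stepS S S' : S \subset S' -> forcing_step e S \subset forcing_step e S'.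
Proof.
move=> sSS'; apply/subsetP=> w; rewrite !inE => /orP[/(subsetP sSS') ->//|].
case/existsP=> u /andP[uS /eqP Nu].
have [//|wS'] := boolP (w \in S'); apply/existsP; exists u.
rewrite (subsetP sSS') //=; apply/eqP/setP=> x; rewrite !inE.
apply/idP/idP=> [/andP[eux xS']|/eqP->].
  have: x \in uncolored_nbrs e S u by rewrite inE eux (contra (subsetP sSS' x)).
  by rewrite Nu inE.
have: w \in uncolored_nbrs e S u by rewrite Nu set11.
by rewrite inE wS' andbT => /andP[].
Qed.

(** By monotonicity of rounds, performing a single available force first loses nothing; this permits
    reasoning one force at a time. *)
Lemma forcing_set_force S u v :
  u \in S -> uncolored_nbrs e S u = [set v] -> forcing_set e (v |: S) -> forcing_set e S.
Proof.
move=> uS Nu /forcing_setP[n Hn]; apply/forcing_setP; exists n.+1.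
apply/eqP; rewrite eqEsubset subsetT -Hn iterSr.
elim: n {Hn} => [|n IHn]; last exact: forcing_stepS.
rewrite subUset sub_forcing_step sub1set andbT !inE; apply/orP; right.
by apply/existsP; exists u; rewrite uS Nu eqxx.
Qed.

(** A set containing [F] in which no force is available contains every iterate started from [F]. *)
Lemma forcing_set_progress F S : forcing_set e F -> F \subset S -> S != setT ->
  exists u v, u \in S /\ uncolored_nbrs e S u = [set v].
Proof.
move=> /forcing_setP[n Hn] sFS.
have [/existsP[u /existsP[v /andP[uS /eqP Nu]]]|stuck] :=
    boolP [exists u, exists v, (u \in S) && (uncolored_nbrs e S u == [set v])].
  by move=> _; exists u, v.
case/eqP; apply/eqP; rewrite eqEsubset subsetT -Hn.
elim: n {Hn} => //= n IHn; apply: subset_trans (forcing_stepS IHn) _.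
apply/subsetP=> v; rewrite !inE => /orP[//|/existsP[u /andP[uS Nu]]].
by case/negP: stuck; apply/existsP; exists u; apply/existsP; exists v; rewrite uS.
Qed.

Lemma forcing_set0 : forcing_set e set0 -> #|T| = 0.
Proof.
move=> f0; apply/eqP; have [/eqP T0|T0] := boolP ([set: T] == set0).
  by rewrite -cardsT T0 cards0.
have [|u [v []]] := forcing_set_progress f0 (subxx _); last by rewrite inE.
by rewrite eq_sym.
Qed.

End Forcing.

(** * Timelines of forcing processes *)

(* The vertex v becomes coloured at time s v (0 if v is in the forcing set),  *)
(* forces at time d v (N if it never forces) and belongs to the chain c v.    *)
(* The axioms are invariant under the time reversal t |-> N - t.              *)
Record timeline (T : finType) (e : rel T) (L : Type) (N : nat)
    (c : T -> L) (s d : T -> nat) : Prop := Timeline {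
  tl_lt : forall v, s v < d v;
  tl_le : forall v, d v <= N;
  tl_next : forall u, d u < N -> exists2 v, c v = c u & s v = d u;
  tl_prev : forall v, 0 < s v -> exists2 u, c u = c v & d u = s v;
  tl_disj : forall u v, c u = c v -> u != v -> d u <= s v \/ d v <= s u;
  tl_consec : forall u v, c u = c v -> d u = s v -> e u v;
  tl_edge : forall u v, e u v -> d v <= s u -> c u = c v /\ d v = s u;
  tl_inj : forall u v, d u = d v -> d v < N -> u = v
}.

Section Timeline.
Variables (T : finType) (e : rel T).
Hypotheses (e_sym : symmetric e) (e_irr : irreflexive e).

(** The state after [n] single forces, with [S] the coloured set. The value [#|T|.+1] of [d] marks
    vertices that have not forced yet; it exceeds all times used, since [ptl_card] bounds [n]. By
    [ptl_closed], a vertex that has forced has no uncoloured neighbour, which is what preserves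
    [ptl_edge] when a vertex is added. *)
Record partial_timeline (F S : {set T}) (L : Type) (n : nat)
    (c : T -> L) (s d : T -> nat) : Prop := PartialTimeline {
  ptl_sub : F \subset S;
  ptl_card : n + #|F| = #|S|;
  ptl_s : forall v, v \in S -> s v <= n;
  ptl_d : forall v, v \in S -> d v <= n \/ d v = #|T|.+1;
  ptl_lt : forall v, v \in S -> s v < d v;
  ptl_next : forall u, u \in S -> d u <= n -> exists2 v, v \in S & c v = c u /\ s v = d u;
  ptl_prev : forall v, v \in S -> 0 < s v -> exists2 u, u \in S & c u = c v /\ d u = s v;
  ptl_disj : {in S &, forall u v, c u = c v -> u != v -> d u <= s v \/ d v <= s u};
  ptl_consec : {in S &, forall u v, c u = c v -> d u = s v -> e u v};
  ptl_edge : {in S &, forall u v, e u v -> d v <= s u -> c u = c v /\ d v = s u};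
  ptl_inj : {in S &, forall u v, d u = d v -> d v <= n -> u = v};
  ptl_closed : forall u v, u \in S -> d u <= n -> e u v -> v \in S
}.

Lemma partial_timeline_extend F S L n (c : T -> L) s d u v :
    partial_timeline F S n c s d -> u \in S -> uncolored_nbrs e S u = [set v] ->
  exists c' s' d', partial_timeline F (v |: S) n.+1 c' s' d' /\ {in S, c' =1 c}.
Proof.
move=> pt uS Nu.
have /[!inE] /andP[euv vS] : v \in uncolored_nbrs e S u by rewrite Nu set11.
have Nu_in x : e u x -> x != v -> x \in S.
  move=> eux; apply: contraNT => xS.
  have: x \in uncolored_nbrs e S u by rewrite inE eux.
  by rewrite Nu inE.
have vF x : x \in S -> (x == v) = false by apply: contraTF => /eqP->.
have nT : n < #|T|.
  have := ptl_card pt; have := max_card (mem (v |: S)); rewrite cardsU1 vS; lia.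
have du : d u = #|T|.+1.
  have [dn|//] := ptl_d pt uS.
  by have := ptl_closed pt uS dn euv; rewrite (negbTE vS).
(* [v] joins the chain of [u] at time [n.+1], the time at which [u] forces, and has itself not
   forced yet. *)
exists (fun x => if x == v then c u else c x), (fun x => if x == v then n.+1 else s x),
  (fun x => if x == v then #|T|.+1 else if x == u then n.+1 else d x).
have uv : (u == v) = false by apply: vF.
split; last by move=> x /vF ->.
constructor.
- by apply: subset_trans (ptl_sub pt) _; apply: subsetUr.
- by rewrite cardsU1 vS addSn (ptl_card pt).
- move=> x /setU1P[->|xS]; rewrite ?eqxx ?vF //.
  by have := ptl_s pt xS; lia.
- move=> x /setU1P[->|xS]; rewrite ?eqxx ?vF //; first by right.
  by case: eqP => _; [left|have [] := ptl_d pt xS; [left; lia|right]].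
- move=> x /setU1P[->|xS]; rewrite ?eqxx ?vF //.
  case: eqP => [->|_]; [by have := ptl_s pt uS; lia|exact: (ptl_lt pt xS)].
- move=> x /setU1P[->|xS]; rewrite ?eqxx ?vF //; first by lia.
  case: eqP => [-> _|xu dx]; first by exists v; rewrite ?setU11 ?eqxx.
  have [dx'|] := ptl_d pt xS; last by lia.
  by have [y yS E] := ptl_next pt xS dx'; exists y; rewrite ?vF // inE yS orbT.
- move=> x /setU1P[->|xS]; rewrite ?eqxx ?vF //.
    by exists u; rewrite ?uv ?eqxx // !inE uS orbT.
  move=> /(ptl_prev pt xS)[y yS [cy dy]]; exists y; first by rewrite !inE yS orbT.
  rewrite vF //; case: eqP => // yu; move: dy; rewrite yu du.
  by have := ptl_s pt xS; lia.
- move=> x y /setU1P[->|xS] /setU1P[->|yS]; rewrite ?eqxx ?vF ?vF //.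
  + move=> cy _; have := ptl_s pt yS; case: eqP; first by right; lia.
    move=> /eqP yu _; have [|] := ptl_d pt yS; first by right; lia.
    move=> dy; have := ptl_disj pt uS yS cy; rewrite eq_sym yu du => /(_ isT).
    by have := ptl_s pt yS; have := ptl_s pt uS; lia.
  + move=> cx _; have := ptl_s pt xS; case: eqP; first by left; lia.
    move=> /eqP xu _; have [|] := ptl_d pt xS; first by left; lia.
    move=> dx; have := ptl_disj pt xS uS cx; rewrite xu du => /(_ isT).
    by have := ptl_s pt xS; have := ptl_s pt uS; lia.
  + move=> cxy xy; have := ptl_disj pt xS yS cxy xy.
    have := ptl_s pt xS; have := ptl_s pt yS.
    by case: eqP => [->|_]; case: eqP => [->|_]; rewrite ?du; lia.
- move=> x y /setU1P[->|xS] /setU1P[->|yS]; rewrite ?eqxx ?vF ?vF //.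
  + by lia.
  + by have := ptl_s pt yS; lia.
  + case: eqP => [->//|xu] _ dx; have [|] := ptl_d pt xS; lia.
  + case: eqP => [-> _ E|_]; last exact: (ptl_consec pt xS yS).
    by have := ptl_s pt yS; lia.
- move=> x y /setU1P[->|xS] /setU1P[->|yS]; rewrite ?eqxx ?vF ?vF //.
  + by rewrite e_irr.
  + case: eqP => [->//|/eqP yu] evy dy.
    have [dy'|] := ptl_d pt yS; last by lia.
    have := ptl_closed pt yS dy'; move: evy; rewrite e_sym => evy /(_ v evy).
    by rewrite (negbTE vS).
  + by have := ptl_s pt xS; lia.
  + case: eqP => [_|_]; first by have := ptl_s pt xS; lia.
    exact: (ptl_edge pt xS yS).
- move=> x y /setU1P[->|xS] /setU1P[->|yS]; rewrite ?eqxx ?vF ?vF //.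
  + by lia.
  + by lia.
  + case: eqP => [->|_]; case: eqP => [->|_] //.
    * by have [] := ptl_d pt yS; lia.
    * by have [] := ptl_d pt xS; lia.
    * move=> E; have [dy _|] := ptl_d pt yS; last by lia.
      exact: (ptl_inj pt xS yS E dy).
- move=> x y /setU1P[->|xS]; rewrite ?eqxx ?vF //; first by lia.
  rewrite !inE; case: eqP => [-> _ euy|_ dx exy].
    by case: eqP => //= /eqP yv; exact: Nu_in.
  have [dx'|] := ptl_d pt xS; last by lia.
  by rewrite (ptl_closed pt xS dx' exy) orbT.
Qed.

Lemma forcing_set_timeline F k : forcing_set e F -> #|F| = k.+1 ->
  exists N (c : T -> 'I_k.+1) s d, timeline e N c s d /\ forall i, exists v, c v = i.
Proof.
move=> fF cF.
pose c0 v : 'I_k.+1 := inord (index v (enum F)).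
have idxF v : v \in F -> index v (enum F) < k.+1.
  by rewrite -cF cardE index_mem mem_enum.
have c0_inj : {in F &, injective c0}.
  move=> u v uF vF /(congr1 val); rewrite /c0 /= !inordK ?idxF // => E.
  by apply: (@index_inj _ u (enum F)); rewrite ?inE ?mem_enum.
have surj0 i : exists2 v, v \in F & c0 v = i.
  have [x0 _] : exists x, x \in F by apply/set0Pn; rewrite -card_gt0 cF.
  have iF : i < size (enum F) by rewrite -cardE cF ltn_ord.
  exists (nth x0 (enum F) i); first by rewrite -mem_enum mem_nth.
  by rewrite /c0 index_uniq ?enum_uniq // inord_val.
have pt0 : partial_timeline F F 0 c0 (fun=> 0) (fun=> #|T|.+1).
  constructor=> //; try lia.
  by move=> u v uF vF /c0_inj-> //; rewrite eqxx.
suff [n [c [s [d [pt surj]]]]] : exists n (c : T -> 'I_k.+1) s d,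
    partial_timeline F setT n c s d /\ forall i, exists v, c v = i.
  have nT : n < #|T|.
    by have := ptl_card pt; rewrite cF cardsT; lia.
  (* The mark for vertices that never force becomes the final time [N]; actual forces happen at
     times at most [n], before it. *)
  exists #|T|.+1, c, s, d; split=> //.
  have dn v : d v < #|T|.+1 -> d v <= n by have [] := ptl_d pt (in_setT v); lia.
  constructor.
  - by move=> v; apply: (ptl_lt pt (in_setT _)).
  - by move=> v; have [] := ptl_d pt (in_setT v); lia.
  - by move=> v /dn dv; have [w _ []] := ptl_next pt (in_setT v) dv; exists w.
  - by move=> v sv; have [w _ []] := ptl_prev pt (in_setT v) sv; exists w.
  - by move=> u v; apply: (ptl_disj pt).
  - by move=> u v; apply: (ptl_consec pt).
  - by move=> u v; apply: (ptl_edge pt).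
  - by move=> u v E /dn; apply: (ptl_inj pt).
suff H m : forall (S : {set T}) n (c : T -> 'I_k.+1) s d, #|T| - #|S| <= m ->
    partial_timeline F S n c s d -> (forall i, exists2 v, v \in S & c v = i) ->
    exists n (c : T -> 'I_k.+1) s d,
      partial_timeline F setT n c s d /\ forall i, exists v, c v = i.
  exact: H (leqnn _) pt0 surj0.
elim: m => [|m IHm] S n c s d cS pt surj.
  have -> : setT = S by apply/eqP; rewrite eq_sym eqEcard subsetT cardsT; lia.
  by exists n, c, s, d; split=> // i; have [v] := surj i; exists v.
have [ST|ST] := eqVneq S setT.
  by rewrite -ST; exists n, c, s, d; split=> // i; have [v] := surj i; exists v.
have [u [v [uS Nu]]] := forcing_set_progress fF (ptl_sub pt) ST.
have [c' [s' [d' [pt' c'c]]]] := partial_timeline_extend pt uS Nu.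
apply: (IHm _ _ _ _ _ _ pt') => [|i].
  have := ptl_card pt'; have := ptl_card pt; lia.
by have [w wS <-] := surj i; exists w; rewrite ?c'c // inE wS orbT.
Qed.

End Timeline.

(** * Time reversal and rerouting of timelines *)

Section Reroute.
Variables (T : finType) (e : rel T) (e_sym : symmetric e).
Variables (L : eqType) (N : nat).
Implicit Types (c : T -> L) (s d : T -> nat).

Lemma tl_start_inj c s d : timeline e N c s d ->
  forall u v, c u = c v -> s u = s v -> u = v.
Proof.
move=> tl u v cuv suv; apply/eqP/negPn/negP => uv.
by have := tl_disj tl cuv uv; have := tl_lt tl u; have := tl_lt tl v; lia.
Qed.

Lemma tl_end_inj c s d : timeline e N c s d ->
  forall u v, c u = c v -> d u = d v -> u = v.
Proof.
move=> tl u v cuv duv; apply/eqP/negPn/negP => uv.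
by have := tl_disj tl cuv uv; have := tl_lt tl u; have := tl_lt tl v; lia.
Qed.

(** Applied to both orientations of an edge between two chains, this says that its ends are active
    at a common time. *)
Lemma tl_cross c s d : timeline e N c s d ->
  forall u v, e u v -> c u != c v -> s u < d v.
Proof.
move=> tl u v /(tl_edge tl) H cuv.
by rewrite ltnNge; apply: contraNN cuv => /H[->].
Qed.

(** The chains are run backwards. The delicate axiom is [tl_inj]: vertices coloured at the same
    positive time have predecessors that force at the same time, hence a common predecessor and a
    common chain. *)
Lemma timeline_rev c s d : timeline e N c s d ->
  timeline e N c (fun v => N - d v) (fun v => N - s v).
Proof.
move=> tl; have lt := tl_lt tl; have le := tl_le tl.
have prev u : N - s u < N -> 0 < s u by lia.
constructor.
- by move=> v; have := lt v; have := le v; lia.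
- by move=> v; lia.
- move=> u /prev /(tl_prev tl)[v cv dv]; exists v => //; lia.
- move=> v Nd; have /(tl_next tl)[u cu su] : d v < N by lia.
  by exists u => //; lia.
- move=> u v cuv uv; have := tl_disj tl cuv uv; lia.
- move=> u v cuv E; rewrite e_sym; apply: (tl_consec tl) => //.
  by have := lt u; have := le u; have := le v; lia.
- move=> u v euv Ns.
  have dsuv : d u <= s v by have := lt v; have := le v; have := le u; lia.
  by move: euv; rewrite e_sym => /(tl_edge tl) /(_ dsuv)[-> ->].
- move=> u v E /prev sv.
  have su : s u = s v by have := lt v; have := le v; have := le u; have := lt u; lia.
  have [v' cv' dv'] := tl_prev tl sv; rewrite -su in sv.
  have [u' cu' du'] := tl_prev tl sv.
  have uv' : u' = v' by apply: (tl_inj tl); have := lt v; have := le v; lia.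
  by apply: (tl_start_inj tl) => //; rewrite -cu' -cv' uv'.
Qed.

(* The chain of x is cut after x, and x now forces the first vertex v of the  *)
(* chain m; the minimality of d x ensures that v, now coloured only at time   *)
(* d x, blocks no earlier force.                                              *)
Lemma timeline_reroute c s d v x :
    timeline e N c s d -> s v = 0 -> e v x -> c x != c v -> d x < d v ->
    (forall w, e v w -> c w != c v -> d x <= d w) ->
  exists c' s', [/\ timeline e N c' s' d,
    [set u | c u == c v] \proper [set u | c' u == c v] &
    (forall i, exists u, c u = i) -> forall i, exists u, c' u = i].
Proof.
move=> tl sv evx cxv dxv minx; have lt := tl_lt tl; have le := tl_le tl.
have dxN : d x < N by have := le v; lia.
have [y cy sy] := tl_next tl dxN.
(* The part of the chain up to [x] takes the label of [v]; the rest, now starting at [y], keeps its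
   label, so no label is lost. Forcing times do not change. *)
pose c' u := if (c u == c x) && (s u <= s x) then c v else c u.
pose s' u := if u == v then d x else if u == y then 0 else s u.
have ncv u : c u = c v -> c' u = c v by rewrite /c' => ->; case: ifP.
have xv : x != v by apply: contraNN cxv => /eqP->.
have yv : y != v by apply: contraNN cxv => /eqP E; rewrite -cy E.
have order u : c u = c x -> u != x -> (s u <= s x) = (d u <= s x).
  by move=> cux ux; have := tl_disj tl cux ux; have := lt u; have := lt x; lia.
have s'E u : u != v -> u != y -> s' u = s u.
  by rewrite /s' => /negbTE-> /negbTE->.
have s'v : s' v = d x by rewrite /s' eqxx.
have s'y : s' y = 0 by rewrite /s' (negbTE yv) eqxx.
have c'E u : c u != c x -> c' u = c u by rewrite /c' => /negbTE->.
have c'l u : c u = c x -> s u <= s x -> c' u = c v by rewrite /c' => -> ->; rewrite eqxx.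
have c'r u : c u = c x -> d x <= s u -> c' u = c x.
  by move=> cux dxs; rewrite /c' cux eqxx leqNgt (leq_trans (lt x) dxs).
have le_x u : c u = c x -> s u <= s x -> d u <= d x /\ s' u = s u.
  move=> cux su; have [->|ux] := eqVneq u x; last first.
    split; first by have := order u cux ux; have := lt x; lia.
    apply: s'E; first by apply: contraNN cxv => /eqP <-; rewrite cux.
    by apply: contraTN su => /eqP->; have := lt x; lia.
  by split=> //; apply: s'E => //; apply: contraTN (lt x) => /eqP E; rewrite {1}E sy; lia.
have gt_x u : c u = c x -> s x < s u -> d x <= s u.
  by move=> cux sxu; have ux : u != x by [apply: contraTN sxu => /eqP->; lia];
     have := tl_disj tl cux ux; have := lt u; lia.
have ge_v u : c u = c v -> d x <= s' u /\ s u <= s' u.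
  move=> cuv; have [->|uv] := eqVneq u v; first by rewrite s'v sv.
  rewrite s'E //; last by apply: contraNN cxv => /eqP E; rewrite -cuv E cy.
  by split=> //; have := tl_disj tl cuv uv; have := lt u; lia.
have ge_y u : c u = c x -> d x <= s u -> u != y -> d y <= s u.
  move=> cux dxs uy; rewrite -cy in cux.
  by have := tl_disj tl cux uy; have := lt u; lia.
exists c', s'; split.
- constructor=> //.
  + move=> u; have [->|uv] := eqVneq u v; first by rewrite s'v.
    have [->|uy] := eqVneq u y; first by rewrite s'y; have := lt y; lia.
    by rewrite s'E.
  + move=> u duN; have [->|ux] := eqVneq u x.
      by exists v; rewrite ?s'v // (c'l x) // c'E // eq_sym.
    have [w cw sw] := tl_next tl duN; exists w; last first.
      rewrite s'E //; first by apply/eqP => E; move: sw; rewrite E sv; have := lt u; lia.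
      apply: contra_neqN ux => /eqP E; apply: (tl_end_inj tl); first by rewrite -cw E.
      by rewrite -sw E.
    rewrite /c' cw sw; case: eqP => //= cux.
    by rewrite (order u) //.
  + move=> u; have [->|uv] := eqVneq u v.
      by exists x; rewrite ?s'v // (c'l x) // c'E // eq_sym.
    have [->|uy] := eqVneq u y; first by rewrite s'y.
    rewrite s'E // => /(tl_prev tl)[p cp dp]; exists p => //.
    rewrite /c' cp -dp; case: eqP => //= cux.
    rewrite (order p) ?cp //; apply: contra_neqN uy => /eqP E.
    by apply: (tl_start_inj tl); rewrite ?cux ?cy // -dp E.
  + have key u w : c u = c v -> c w = c x -> s w <= s x -> d w <= s' u.
      by move=> /ge_v[] ? _ cw /(le_x _ cw)[] ? _; lia.
    have key2 u w : c u = c x -> s x < s u -> c w = c x -> s x < s w -> u != w ->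
        d u <= s' w \/ d w <= s' u.
      move=> cu su cw sw uw.
      have uv : u != v by apply: contraNN cxv => /eqP <-; rewrite cu.
      have wv : w != v by apply: contraNN cxv => /eqP <-; rewrite cw.
      have [uy|uy] := eqVneq u y.
        left; rewrite uy s'E //; last by rewrite -uy eq_sym.
        by apply: ge_y => //; [exact: gt_x|rewrite -uy eq_sym].
      rewrite (s'E u) //.
      have [wy|wy] := eqVneq w y; first by right; rewrite wy; apply: ge_y => //; exact: gt_x.
      by rewrite (s'E w) //; apply: (tl_disj tl); rewrite ?cu ?cw.
    move=> u w c'uw uw.
    have [cux|cux] := eqVneq (c u) (c x); have [cwx|cwx] := eqVneq (c w) (c x).
    * case: (leqP (s u) (s x)) => su; case: (leqP (s w) (s x)) => sw.
      - rewrite (le_x _ cux su).2 (le_x _ cwx sw).2; apply: (tl_disj tl) => //.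
        by rewrite cux cwx.
      - by move: c'uw; rewrite c'l // c'r ?gt_x // => E; move: cxv; rewrite E eqxx.
      - by move: c'uw; rewrite c'r ?gt_x // c'l // => E; move: cxv; rewrite E eqxx.
      - exact: key2.
    * move: c'uw; rewrite (c'E w) //; case: (leqP (s u) (s x)) => su.
        by rewrite c'l // => /esym cw; left; apply: key.
      by rewrite c'r ?gt_x // => E; rewrite E eqxx in cwx.
    * move: c'uw; rewrite (c'E u) //; case: (leqP (s w) (s x)) => sw.
        by rewrite c'l // => cw; right; apply: key.
      by rewrite c'r ?gt_x // => E; rewrite E eqxx in cux.
    * move: c'uw; rewrite !c'E // => cuw.
      have sl z : c z != c x -> s z <= s' z.
        move=> cz; have [->|zv] := eqVneq z v; first by rewrite sv.
        by rewrite s'E //; apply: contraNN cz => /eqP->; rewrite cy.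
      by have := tl_disj tl cuw uw; have := sl _ cux; have := sl _ cwx; lia.
  + move=> u w c'uw; have [->|wv] := eqVneq w v.
      by rewrite s'v => /(tl_inj tl) /(_ dxN)->; rewrite e_sym.
    have [->|wy] := eqVneq w y; first by rewrite s'y; have := lt u; lia.
    rewrite s'E // => E; apply: (tl_consec tl) => //; move: c'uw.
    have [cux|cux] := eqVneq (c u) (c x); have [cwx|cwx] := eqVneq (c w) (c x).
    * by rewrite cux cwx.
    * case: (leqP (s u) (s x)) => su; rewrite (c'E w) //;
      last by rewrite c'r ?gt_x // => E'; rewrite E' eqxx in cwx.
      rewrite c'l // => cvw; have [dux _] := le_x u cux su.
      by have := tl_disj tl cvw; rewrite eq_sym => /(_ wv); have := lt w; lia.
    * case: (leqP (s w) (s x)) => sw; rewrite (c'E u) //;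
      last by rewrite c'r ?gt_x // => E'; rewrite E' eqxx in cux.
      rewrite c'l // => cuv; have [dwx _] := le_x w cwx sw.
      have [uv|uv] := eqVneq u v; first by move: E; rewrite uv; have := lt w; lia.
      by have := tl_disj tl cuv uv; have := lt w; have := lt u; lia.
    * by rewrite !c'E.
  + move=> u w euw; have [uv|uv] := eqVneq u v.
      rewrite uv s'v => dwx; have [cwv|cwv] := eqVneq (c w) (c v).
        have [wv|wv] := eqVneq w v; first by move: dwx; rewrite wv; lia.
        by have := tl_disj tl cwv wv; have := lt w; lia.
      (* By minimality of [d x], the only neighbour of [v] outside its chain that forces by time
         [d x] is [x], which forces [v]. *)
      have /eqP E : d w == d x by rewrite eqn_leq dwx minx // -uv.
      have -> : w = x by apply: (tl_inj tl) => //.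
      by rewrite (c'l x) // c'E // eq_sym.
    have [->|uy] := eqVneq u y; first by rewrite s'y; have := lt w; lia.
    rewrite s'E // => /(tl_edge tl euw)[cuw dwu]; split=> //.
    have [wx|wx] := eqVneq w x.
      case/eqP: uy; apply: (tl_start_inj tl); first by rewrite cuw wx cy.
      by rewrite sy -dwu wx.
    rewrite /c' cuw -dwu; case: eqP => //= cwx; by rewrite -order.
  + exact: (tl_inj tl).
- rewrite properE; apply/andP; split; first by apply/subsetP=> u; rewrite !inE => /eqP/ncv->.
  by apply/subsetPn; exists x; rewrite !inE ?c'l.
- move=> surj i; have [u cu] := surj i.
  have [E|cux] := eqVneq (c u) (c x); first by exists y; rewrite c'r ?sy // -E.
  by exists u; rewrite c'E.
Qed.

End Reroute.

(** * Timelines with a locally longest middle chain *)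

Section Maximal.
Variables (T : finType) (e : rel T) (e_sym : symmetric e).
Variables (L : eqType) (N : nat) (m : L).
Implicit Types (c : T -> L) (s d : T -> nat).

(** If a first vertex of chain [m] has a neighbour in another chain that forces before it does, then
    rerouting through the earliest such neighbour lengthens chain [m]. *)
Lemma timeline_first_or_longer c s d : timeline e N c s d ->
  (forall i, exists v, c v = i) ->
  (forall v x, c v = m -> s v = 0 -> e v x -> c x != m -> d v <= d x) \/
  exists c' s' d', [/\ timeline e N c' s' d', forall i, exists v, c' v = i &
    #|[set v | c v == m]| < #|[set v | c' v == m]|].
Proof.
move=> tl surj.
pose bad v := [pred x | [&& e v x, c x != m & d x < d v]].
have [/existsP[v /and3P[/eqP cv /eqP sv /existsP[x0 bx0]]]|nobad] :=
    boolP [exists v, [&& c v == m, s v == 0 & [exists x, bad v x]]]; last first.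
  left=> v x cv sv evx cx; rewrite leqNgt; apply: contraNN nobad => dxv.
  by apply/existsP; exists v; rewrite cv sv !eqxx; apply/existsP; exists x; apply/and3P.
right; case: (arg_minnP d bx0) => x /and3P[evx cx dxv] minx.
have [||c' [s' [tl' prop surj']]] := timeline_reroute e_sym tl sv evx _ dxv.
- by rewrite cv.
- move=> w evw cw; have [dwv|] := ltnP (d w) (d v); last by lia.
  by apply: minx; rewrite /= evw dwv -cv cw.
- by exists c', s', d; split=> //; [exact: surj'|rewrite -cv; apply: proper_card].
Qed.

(** Time reversal exchanges the two conditions. *)
Definition active_at_ends c s d :=
  (forall v x, c v = m -> s v = 0 -> e v x -> c x != m -> d v <= d x) /\
  (forall v x, c v = m -> d v = N -> e v x -> c x != m -> s x <= s v).

(** Reversal leaves the labels unchanged, so the length of chain [m], bounded by [#|T|], increases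
    whichever end is rerouted. *)
Lemma timeline_maximal c s d : timeline e N c s d ->
  (forall i, exists v, c v = i) ->
  exists c' s' d', [/\ timeline e N c' s' d', forall i, exists v, c' v = i &
    active_at_ends c' s' d'].
Proof.
have [n] := ubnP (#|T| - #|[set v | c v == m]|).
elim: n => // n IHn in c s d *; move=> lt_n tl surj.
have step c' s' d' : timeline e N c' s' d' -> (forall i, exists v, c' v = i) ->
    #|[set v | c v == m]| < #|[set v | c' v == m]| ->
    exists c' s' d', [/\ timeline e N c' s' d', forall i, exists v, c' v = i &
      active_at_ends c' s' d'].
  move=> tl' surj' lt_c; apply: (IHn _ _ _ _ tl' surj').
  by have : #|[set v | c' v == m]| <= #|T| by [exact: max_card]; lia.
have [first|[c' [s' [d' [tl' surj' lt_c]]]]] := timeline_first_or_longer tl surj;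
  last exact: (step _ _ _ tl' surj' lt_c).
have [last|[c' [s' [d' [tl' surj' lt_c]]]]] :=
  timeline_first_or_longer (timeline_rev e_sym tl) surj;
  last exact: (step _ _ _ tl' surj' lt_c).
exists c, s, d; split=> //; split=> // v x cv dv evx cx.
have := last v x cv _ evx cx; rewrite dv subnn => /(_ erefl).
have := tl_le tl v; have := tl_lt tl v; have := tl_le tl x; have := tl_lt tl x; lia.
Qed.

(** The activity of [v] overlaps those of [x] and [x']. At an end of chain [m], [active_at_ends]
    passes the comparison through [v]; an interior [v] already has two neighbours in its chain, and
    distinct [x], [x'] would give it degree 4. *)
Lemma timeline_cross_nbrs c s d : max_degree e <= 3 -> timeline e N c s d ->
  active_at_ends c s d -> forall v x x',
  c v = m -> e v x -> c x != m -> e v x' -> c x' != m -> s x < d x'.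
Proof.
move=> deg3 tl [first last] v x x' cv evx cx evx' cx'.
have exv : e x v by rewrite e_sym.
have [->|xx'] := eqVneq x x'; first exact: (tl_lt tl).
have sxdv : s x < d v by apply: (tl_cross tl exv); rewrite cv.
have svdx' : s v < d x' by apply: (tl_cross tl evx'); rewrite cv eq_sym.
have [/eqP sv|sv] := boolP (s v == 0); first by apply: leq_trans sxdv _; apply: (first v).
have [/eqP dv|dv] := boolP (d v == N); first by apply: leq_ltn_trans svdx'; apply: (last v).
have [|p cp dp] := tl_prev tl (v := v); first by lia.
have [|q cq sq] := tl_next tl (u := v); first by have := tl_le tl v; lia.
have evp : e v p by rewrite e_sym; apply: (tl_consec tl).
have evq : e v q by apply: (tl_consec tl).
have pq : p != q.
  apply/eqP => E; have := tl_lt tl p; have := tl_lt tl v; rewrite {1}E sq -dp; lia.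
have sub : [set x; x'; p; q] \subset [set u | e v u].
  by apply/subsetP=> u; rewrite !inE -!orbA => /or4P[] /eqP->.
have ndiff z w : c z != m -> c w = c v -> z != w.
  by move=> cz cw; apply: contraNN cz => /eqP->; rewrite cw cv.
have := leq_trans (subset_leq_card sub) (leq_bigmax (F := fun v => #|[set u | e v u]|) v).
rewrite -/(max_degree e) => /leq_trans/(_ deg3).
rewrite -!setUA !cardsU1 cards1 !inE !negb_or xx' pq !ndiff //.
Qed.

End Maximal.

(** * Coordinates of the drawing *)

Section Coordinates.
Variables (T : finType) (e : rel T) (e_sym : symmetric e).
Variables (N : nat) (l s d : T -> nat).
Hypothesis tl : timeline e N l s d.
Hypothesis cross_nbrs : forall v x x',
  l v = 1 -> e v x -> l x != 1 -> e v x' -> l x' != 1 -> s x < d x'.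

Definition outer_edge (f : T * T) := [&& e f.1 f.2, l f.1 == 0 & l f.2 == 2].

(* The outer edge f has to cross the middle line to the left of v. *)
Definition left_of (v : T) (f : T * T) :=
  (minn (d f.1) (d f.2) <= s v) ||
  [exists x, e v x && ((l x == 0) && (d f.1 <= s x) || (l x == 2) && (d f.2 <= s x))].

(** The outer edges are totally ordered by the sum of the times of their ends; those left of [v] are
    exactly those with [(s f.1 + s f.2).+1] at most [gap v], by [left_of_gap] and [not_left_of_gap].
    It is 0 if there are none. *)
Definition gap v := \max_(f | outer_edge f && left_of v f) (s f.1 + s f.2).+1.

(* An outer edge f crosses the middle line at N.+2 * (s f.1 + s f.2).+1. *)
Definition abscissa v :=
  if l v == 1 then N.+2 * gap v + (s v).+1 else N.+2 * (s v).*2.+1.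

(** If [u] came before [u'] but [v'] before [v], then [d u <= s u' < d v' <= s v < d u], the strict
    steps being overlaps along edges. *)
Lemma parallel_edges u v u' v' : e u v -> e u' v' -> l u != l v ->
  l u = l u' -> l v = l v' ->
  (s u <= s u') && (s v <= s v') || (s u' <= s u) && (s v' <= s v).
Proof.
move=> euv euv' luv lu lv.
have [->|uu'] := eqVneq u u'; first by rewrite leqnn leq_total.
have [->|vv'] := eqVneq v v'; first by rewrite leqnn !andbT leq_total.
have h1 : s u < d v := tl_cross tl euv luv.
have h2 : s v < d u by apply: (tl_cross tl); rewrite 1?e_sym // eq_sym.
have h3 : s u' < d v' by apply: (tl_cross tl) => //; rewrite -lu -lv.
have h4 : s v' < d u' by apply: (tl_cross tl); rewrite 1?e_sym // -lu -lv eq_sym.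
have := tl_disj tl lu uu'; have := tl_disj tl lv vv'.
have := tl_lt tl u; have := tl_lt tl v; have := tl_lt tl u'; have := tl_lt tl v'; lia.
Qed.

Lemma outer_overlap f : outer_edge f -> s f.1 < d f.2 /\ s f.2 < d f.1.
Proof.
case/and3P=> ef /eqP l1 /eqP l2.
by split; apply: (tl_cross tl); rewrite ?l1 ?l2 // e_sym.
Qed.

(** This is where [cross_nbrs] enters. If an end of [f] is finished before [v] starts, it is
    finished before [x] forces, since [v] and [x] overlap; if it is finished before another outer
    neighbour [x'] of [v] starts, the same follows from [s x' < d x]. *)
Lemma left_of_endpoint v x f :
  l v = 1 -> e v x -> l x != 1 -> outer_edge f -> left_of v f ->
  (l x = 0 -> s f.1 <= s x) /\ (l x = 2 -> s f.2 <= s x).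
Proof.
move=> lv evx lx of_ lvf; have [o1 o2] := outer_overlap of_.
have /and3P[_ /eqP l1 /eqP l2] := of_.
have svx : s v < d x by apply: (tl_cross tl evx); rewrite lv eq_sym.
have aux a : l a = l x -> s a < d x -> s a <= s x.
  move=> lax sax; have [->//|ax] := eqVneq a x.
  by have := tl_disj tl lax ax; have := tl_lt tl a; lia.
have t1 := tl_lt tl f.1; have t2 := tl_lt tl f.2.
suff [H1 H2] : s f.1 < d x /\ s f.2 < d x.
  by split=> lx'; apply: aux => //; rewrite lx'.
case/orP: lvf => [|/existsP[x' /andP[evx' lx']]]; first by lia.
have lx'1 : l x' != 1 by case/orP: lx' => /andP[/eqP->].
have sx' : s x' < d x by apply: (cross_nbrs lv evx' lx'1 evx lx).
by case/orP: lx' => /andP[_]; lia.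
Qed.

Lemma not_left_of_endpoint v x f : e v x -> outer_edge f -> ~~ left_of v f ->
  (l x = 0 -> s x <= s f.1) /\ (l x = 2 -> s x <= s f.2).
Proof.
move=> evx /and3P[_ /eqP l1 /eqP l2]; rewrite negb_or => /andP[_ /existsPn/(_ x)].
rewrite evx /= negb_or => /andP[n1 n2].
have aux a : l x = l a -> ~~ (d a <= s x) -> s x <= s a.
  move=> lax sax; have [->//|ax] := eqVneq x a.
  by have := tl_disj tl lax ax; have := tl_lt tl x; lia.
by split=> lx; apply: aux; rewrite ?l1 ?l2 //; [move: n1|move: n2]; rewrite lx.
Qed.

Lemma left_of_gap v f : outer_edge f -> left_of v f -> (s f.1 + s f.2).+1 <= gap v.
Proof.
move=> of_ lf.
exact: (@leq_bigmax_cond _ _ (fun f => (s f.1 + s f.2).+1) f (introT andP (conj of_ lf))).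
Qed.

(** By [parallel_edges], an outer edge whose sum is at most that of an edge left of [v] has both
    ends no later than the ends of that edge, and is then itself left of [v]. *)
Lemma not_left_of_gap v f : outer_edge f -> ~~ left_of v f -> gap v <= s f.1 + s f.2.
Proof.
move=> of_ nlf; apply/bigmax_leqP => g /andP[og lg].
have /and3P[ef /eqP lf1 /eqP lf2] := of_; have /and3P[eg /eqP lg1 /eqP lg2] := og.
have := parallel_edges ef eg; rewrite lf1 lf2 lg1 lg2 => /(_ isT erefl erefl) par.
rewrite ltnNge; apply: contraNN nlf => le_fg.
have {par} [s1 s2] : s f.1 <= s g.1 /\ s f.2 <= s g.2 by lia.
have dmono a b : l a = l b -> s a <= s b -> d a <= d b.
  move=> lab sab; have [->//|ab] := eqVneq a b.
  by have := tl_disj tl lab ab; have := tl_lt tl a; have := tl_lt tl b; lia.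
have d1 : d f.1 <= d g.1 by apply: dmono; rewrite ?lf1.
have d2 : d f.2 <= d g.2 by apply: dmono; rewrite ?lf2.
case/orP: lg => [dg|/existsP[x /andP[evx lx]]]; apply/orP.
  left; lia.
right; apply/existsP; exists x; rewrite evx /=; lia.
Qed.

Lemma gap_mono u v : l u = 1 -> l v = 1 -> s u < s v -> gap u <= gap v.
Proof.
move=> lu lv suv; apply/bigmax_leqP => f /andP[of_ lf]; apply: left_of_gap => //.
have duv : d u <= s v.
  have := tl_disj tl (u := u) (v := v); rewrite lu lv => /(_ erefl).
  have uv : u != v by [apply: contraTN suv => /eqP->; rewrite ltnn].
  by move=> /(_ uv); have := tl_lt tl u; have := tl_lt tl v; lia.
apply/orP; left; case/orP: lf => [|/existsP[x /andP[eux lx]]]; first by lia.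
have sxu : s x < d u.
  apply: (tl_cross tl); rewrite 1?e_sym // lu.
  by case/orP: lx => /andP[/eqP->].
by case/orP: lx => /andP[_]; lia.
Qed.

Lemma abscissa_mono u v : l u = l v -> s u < s v -> abscissa u < abscissa v.
Proof.
move=> luv suv; rewrite /abscissa luv; case: eqP => lv; last by nia.
have := gap_mono (etrans luv lv) lv suv; nia.
Qed.

Lemma abscissa_inj u v : l u = l v -> abscissa u = abscissa v -> u = v.
Proof.
move=> luv X; apply: (tl_start_inj tl luv).
by case: (ltngtP (s u) (s v)) => //; [move/(abscissa_mono luv)|move/(abscissa_mono (esym luv))];
   rewrite X ltnn.
Qed.

Lemma abscissa_le u v : l u = l v -> s u <= s v -> abscissa u <= abscissa v.
Proof.
move=> luv; rewrite leq_eqVlt => /orP[/eqP E|]; last by move/(abscissa_mono luv)/ltnW.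
by rewrite (tl_start_inj tl luv E).
Qed.

Lemma abscissa_outer f : outer_edge f ->
  abscissa f.1 + abscissa f.2 = (N.+2 * (s f.1 + s f.2).+1).*2.
Proof. by case/and3P=> _ /eqP l1 /eqP l2; rewrite /abscissa l1 l2 /=; lia. Qed.

(* Twice the abscissa at height j of the segment joining u to v. *)
Definition level (u v : T) (j : nat) :=
  if j == l u then (abscissa u).*2
  else if j == l v then (abscissa v).*2 else abscissa u + abscissa v.

Lemma level_middle v f : l v = 1 -> outer_edge f ->
  if left_of v f then abscissa f.1 + abscissa f.2 < (abscissa v).*2
  else (abscissa v).*2 < abscissa f.1 + abscissa f.2.
Proof.
move=> lv of_; rewrite (abscissa_outer of_) /abscissa lv eqxx.
have svN : s v < N by apply: leq_trans (tl_lt tl v) (tl_le tl v).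
case: ifP => [/(left_of_gap of_)|/negbT /(not_left_of_gap of_)] g; rewrite ltn_double; nia.
Qed.

Definition rising (u v : T) := [&& e u v, l u < l v & l v <= 2].

Lemma risingP u v : rising u v -> e u v /\
  [\/ l u = 0 /\ l v = 1, l u = 1 /\ l v = 2 | l u = 0 /\ l v = 2].
Proof.
case/and3P=> euv; case: (l u) (l v) => [|[|[|?]]] [|[|[|?]]] // _ _.
- by split=> //; constructor 1.
- by split=> //; constructor 3.
- by split=> //; constructor 2.
Qed.

Lemma level_parallel u v u' v' j :
    e u v -> e u' v' -> l u < l v -> l u = l u' -> l v = l v' -> l u <= j -> j < l v ->
  level u v j <= level u' v' j /\ level u v j.+1 <= level u' v' j.+1 \/
  level u' v' j <= level u v j /\ level u' v' j.+1 <= level u v j.+1.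
Proof.
move=> euv euv' luv lu lv uj jv.
have luv' : l u != l v by lia.
rewrite /level -lu -lv.
by case/orP: (parallel_edges euv euv' luv' lu lv) => /andP[];
  [move=> /(abscissa_le lu) ? /(abscissa_le lv) ?; left
  |move=> /(abscissa_le (esym lu)) ? /(abscissa_le (esym lv)) ?; right];
  split; do 2?[case: ifP => _]; lia.
Qed.

(** At the middle height the order is decided by [left_of]; the endpoint lemmas give the same order
    on the outer line. *)
Lemma level_outer u v y z j : rising u v -> outer_edge (y, z) -> l u = 1 \/ l v = 1 ->
    l u <= j -> j < l v ->
  level u v j <= level y z j /\ level u v j.+1 <= level y z j.+1 \/
  level y z j <= level u v j /\ level y z j.+1 <= level u v j.+1.
Proof.
move=> /risingP[euv luv] oyz luv1; have /and3P[/= eyz /eqP ly /eqP lz] := oyz.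
case: luv luv1 => -[lu lv] luv1 uj jv; last by rewrite lu lv in luv1; case: luv1.
- have -> : j = 0 by lia.
  rewrite /level ly lz lu lv /=.
  have := level_middle lv oyz; have evu : e v u by rewrite e_sym.
  have luy : l u = l y by rewrite lu.
  have lu1 : l u != 1 by rewrite lu.
  case: ifP => [lf|/negbT lf] X; [right|left]; split; try by apply: ltnW.
    by rewrite leq_double abscissa_le //; apply: (left_of_endpoint lv evu lu1 oyz lf).1.
  by rewrite leq_double abscissa_le //; apply: (not_left_of_endpoint evu oyz lf).1.
- have -> : j = 1 by lia.
  rewrite /level ly lz lu lv /=.
  have := level_middle lu oyz.
  have lvz : l v = l z by rewrite lv.
  have lv1 : l v != 1 by rewrite lv.
  case: ifP => [lf|/negbT lf] X; [right|left]; split; try by apply: ltnW.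
    by rewrite leq_double abscissa_le //; apply: (left_of_endpoint lu euv lv1 oyz lf).2.
  by rewrite leq_double abscissa_le //; apply: (not_left_of_endpoint euv oyz lf).2.
Qed.

(** Within one strip between consecutive lines, the order of two segments is the same on both
    boundaries, so they do not cross inside it. *)
Lemma level_order u v u' v' j : rising u v -> rising u' v' ->
    l u <= j -> j < l v -> l u' <= j -> j < l v' ->
  level u v j <= level u' v' j /\ level u v j.+1 <= level u' v' j.+1 \/
  level u' v' j <= level u v j /\ level u' v' j.+1 <= level u v j.+1.
Proof.
move=> r r' uj jv uj' jv'; have [euv luv] := risingP r; have [euv' luv'] := risingP r'.
have [/andP[/eqP lu /eqP lv]|par] := boolP ((l u == l u') && (l v == l v')).
  by apply: level_parallel => //; apply: leq_ltn_trans jv.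
have [o'|o'] := boolP (outer_edge (u', v')).
  by apply: level_outer => //; move/and3P: o' => [_ /= /eqP ? /eqP ?]; case: luv; lia.
have [o|o] := boolP (outer_edge (u, v)).
  apply/or_comm; apply: level_outer => //; move/and3P: o => [_ /= /eqP ? /eqP ?].
  by case: luv'; lia.
by move: o o'; rewrite /outer_edge euv euv' /=; case: luv; case: luv'; lia.
Qed.

Lemma level_endpoint u v w : rising u v -> l u <= l w <= l v ->
  level u v (l w) = (abscissa w).*2 -> w \in [set u; v].
Proof.
move=> /risingP[euv luv] uwv; rewrite /level !inE.
case: eqP => [luw|luw].
  by move=> H; apply/orP; left; apply/eqP/abscissa_inj; lia.
case: eqP => [lvw|lvw].
  by move=> H; apply/orP; right; apply/eqP/abscissa_inj; lia.
have lw : l w = 1 by case: luv; lia.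
have ouv : outer_edge (u, v) by rewrite /outer_edge /= euv; case: luv; lia.
by have := level_middle lw ouv; case: ifP => _ /=; lia.
Qed.

(** If [j] is the height of no end, then [j] is 1 and both edges are outer; [parallel_edges] orders
    their ends, so equal sums of abscissas make the edges equal. *)
Lemma level_eq u v u' v' j : rising u v -> rising u' v' ->
    l u <= j <= l v -> l u' <= j <= l v' -> level u v j = level u' v' j ->
  (u, v) = (u', v') \/
  exists w, [/\ w \in [set u; v] :&: [set u'; v'], l w = j & level u v j = (abscissa w).*2].
Proof.
move=> r r' uj uj' E; have [euv luv] := risingP r; have [euv' luv'] := risingP r'.
have key x y z y' z' : x \in [set y; z] -> rising y z -> rising y' z' -> l x = j ->
    level y z j = level y' z' j -> l y' <= j <= l z' ->
    [/\ x \in [set y; z] :&: [set y'; z'], l x = j & level y z j = (abscissa x).*2].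
  move=> xyz ryz ry'z' lx E' j'.
  have Ex : level y z j = (abscissa x).*2.
    have [_ lyz] := risingP ryz.
    move: xyz lx; rewrite /level !inE => /orP[] /eqP-> <-; rewrite eqxx //.
    by case: eqP; case: lyz; lia.
  by split=> //; rewrite inE xyz level_endpoint // lx // -E'.
have [ju|ju] := eqVneq (l u) j.
  by right; exists u; apply: key => //; rewrite !inE eqxx.
have [jv|jv] := eqVneq (l v) j.
  by right; exists v; apply: key => //; rewrite !inE eqxx orbT.
have [ju'|ju'] := eqVneq (l u') j.
  right; exists u'; rewrite setIC E; apply: key => //; by rewrite !inE eqxx.
have [jv'|jv'] := eqVneq (l v') j.
  right; exists v'; rewrite setIC E; apply: key => //; by rewrite !inE eqxx orbT.
left; have j1 : j = 1 by case: luv; lia.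
have o : outer_edge (u, v) by rewrite /outer_edge /= euv; case: luv; lia.
have o' : outer_edge (u', v') by rewrite /outer_edge /= euv'; case: luv'; lia.
have lu : l u = l u' by case: luv; case: luv'; lia.
have lv : l v = l v' by case: luv; case: luv'; lia.
have luv1 : l u != l v by lia.
move: E; rewrite /level [j == _]eq_sym (negbTE ju) [j == _]eq_sym (negbTE jv).
rewrite [j == _]eq_sym (negbTE ju') [j == _]eq_sym (negbTE jv') => E.
suff [Eu Ev] : abscissa u = abscissa u' /\ abscissa v = abscissa v'.
  by rewrite (abscissa_inj lu Eu) (abscissa_inj lv Ev).
by case/orP: (parallel_edges euv euv' luv1 lu lv) => /andP[];
  [move=> /(abscissa_le lu) ? /(abscissa_le lv) ?
  |move=> /(abscissa_le (esym lu)) ? /(abscissa_le (esym lv)) ?]; lia.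
Qed.

End Coordinates.

(** * Linear interpolation along segments *)

Section Segments.
Local Open Scope ring_scope.

Lemma on_segmentC (R : realType) (q a b : R * R) : on_segment q a b -> on_segment q b a.
Proof.
case=> t /andP[t0 t1] ->; exists (1 - t); first by apply/andP; split; lra.
by congr pair; ring.
Qed.

Lemma interpolation_eq (R : realFieldType) (a b a' b' t : R) : 0 <= t <= 1 ->
  a <= a' /\ b <= b' \/ a' <= a /\ b' <= b ->
  (1 - t) * a + t * b = (1 - t) * a' + t * b' ->
  (t < 1 -> a = a') /\ (0 < t -> b = b').
Proof. by move=> /andP[t0 t1] H E; split=> tt; case: H => -[h1 h2]; nra. Qed.

Lemma crossing_parameter (R : realFieldType) (a b a' b' : R) : a < a' -> b' <= b ->
  exists2 t, 0 <= t <= 1 & (1 - t) * a + t * b = (1 - t) * a' + t * b'.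
Proof.
move=> aa' bb'; have D : 0 < (a' - a) + (b - b') by lra.
(* The zero of the affine function interpolating between [a' - a] and [b' - b]. *)
exists ((a' - a) / ((a' - a) + (b - b'))).
  by apply/andP; split; [apply: divr_ge0; lra|rewrite ler_pdivrMr //; lra].
by field; lra.
Qed.

Lemma between_convex (R : realFieldType) (x y z : R) :
  (x < y) && (y < z) || (z < y) && (y < x) ->
  exists2 t, 0 <= t <= 1 & y = (1 - t) * x + t * z.
Proof.
case/orP=> /andP[h1 h2].
  exists ((y - x) / (z - x)); last by field; lra.
  by apply/andP; split; [apply: divr_ge0; lra|rewrite ler_pdivrMr; lra].
exists ((x - y) / (x - z)); last by field; lra.
by apply/andP; split; [apply: divr_ge0; lra|rewrite ler_pdivrMr; lra].
Qed.

End Segments.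

(** * The segments of the drawing do not cross *)

Section Geometry.
Local Open Scope ring_scope.
Variables (R : realType) (T : finType) (e : rel T) (e_sym : symmetric e).
Variables (N : nat) (l s d : T -> nat).
Hypothesis tl : timeline e N l s d.
Hypothesis cross_nbrs : forall v x x',
  l v = 1%N -> e v x -> l x != 1%N -> e v x' -> l x' != 1%N -> (s x < d x')%N.

Definition position v : R * R := ((abscissa e N l s d v)%:R, (l v)%:R).

Local Notation lvl := (level e N l s d).
Local Notation rise := (rising e l).

(** An outer segment spans two strips and its level at height 1 is that of its midpoint, so every
    segment interpolates its levels strip by strip. *)
Lemma on_segment_level u v q : rise u v -> on_segment q (position u) (position v) ->
  (l u)%:R <= q.2 <= (l v)%:R /\ forall j, (l u <= j)%N -> (j < l v)%N ->
  2 * q.1 = (1 - (q.2 - j%:R)) * (lvl u v j)%:R + (q.2 - j%:R) * (lvl u v j.+1)%:R.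
Proof.
move=> /risingP[euv luv] [t /andP[t0 t1] ->] /=; split.
  by case: luv => -[-> ->]; lra.
move=> j uj jv; rewrite /level -!addnn.
have : [\/ (l u = 0 /\ l v = 1) /\ j = 0, (l u = 1 /\ l v = 2) /\ j = 1
    | (l u = 0 /\ l v = 2) /\ (j = 0 \/ j = 1)]%N.
  by case: luv => luv; [constructor 1|constructor 2|constructor 3]; lia.
by case=> -[[-> ->]]; [move=> ->|move=> ->|case=> ->] => /=; rewrite !natrD; field.
Qed.

Lemma on_segment_vertex u v w : rise u v ->
  on_segment (position w) (position u) (position v) -> w \in [set u; v].
Proof.
move=> r /(on_segment_level r)[/=]; rewrite !ler_nat => uwv lev.
apply: (level_endpoint e_sym tl r uwv).
apply: (mulrIn (@oner_neq0 R)); rewrite -addnn natrD; have /andP[uw wv] := uwv.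
have [lwv|lwv] := ltnP (l w) (l v); first by have := lev _ uw lwv; rewrite subrr; lra.
have E : l w = l v by apply/eqP; rewrite eqn_leq wv lwv.
have /and3P[_ luv _] := r; rewrite -E in luv.
have pw := ltn_predK luv; rewrite -{1}pw ltnS in luv.
have := lev _ luv; rewrite -E pw leqnn => /(_ isT).
have -> : (l w)%:R - (l w).-1%:R = 1 :> R by rewrite -{1}pw -natr1 addrAC subrr add0r.
by rewrite subrr; lra.
Qed.

Lemma rising_segments u v u' v' q : rise u v -> rise u' v' -> (u, v) <> (u', v') ->
  on_segment q (position u) (position v) -> on_segment q (position u') (position v') ->
  exists2 w, w \in [set u; v] :&: [set u'; v'] & q = position w.
Proof.
move=> r r' ne qu qu'; have [/andP[uq qv] lev] := on_segment_level r qu.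
have [/andP[uq' qv'] lev'] := on_segment_level r' qu'.
have [euv luv] := risingP r; have [euv' luv'] := risingP r'.
have meet j : q.2 = j%:R -> (l u <= j <= l v)%N -> (l u' <= j <= l v')%N ->
    lvl u v j = lvl u' v' j -> 2 * q.1 = (lvl u v j)%:R ->
    exists2 w, w \in [set u; v] :&: [set u'; v'] & q = position w.
  move=> qj juv juv' E q1.
  case: (level_eq e_sym tl r r' juv juv' E) => [//|[w [wI lw Ew]]].
  exists w => //; rewrite [q]surjective_pairing /position qj lw; congr pair.
  by move: q1; rewrite Ew -addnn natrD; lra.
have strip j : (l u <= j)%N -> (j < l v)%N -> (l u' <= j)%N -> (j < l v')%N ->
    j%:R <= q.2 <= j.+1%:R ->
    exists2 w, w \in [set u; v] :&: [set u'; v'] & q = position w.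
  move=> uj jv uj' jv' /andP[jq qj].
  have E := lev j uj jv; have E' := lev' j uj' jv'.
  have t01 : 0 <= q.2 - j%:R <= 1 by rewrite subr_ge0 jq lerBlDl -natr1 // in qj *.
  have ord : let a := (lvl u v j)%:R : R in let b := (lvl u v j.+1)%:R : R in
    let a' := (lvl u' v' j)%:R : R in let b' := (lvl u' v' j.+1)%:R : R in
    a <= a' /\ b <= b' \/ a' <= a /\ b' <= b.
    by rewrite /= !ler_nat; apply: (level_order e_sym tl cross_nbrs r r').
  have [Ea Eb] := interpolation_eq t01 ord (etrans (esym E) E').
  have {}Ea : q.2 < j.+1%:R -> lvl u v j = lvl u' v' j.
    by move=> qj1; apply: (mulrIn (@oner_neq0 R)); apply: Ea; rewrite -natr1 in qj1; lra.
  have {}Eb : j%:R < q.2 -> lvl u v j.+1 = lvl u' v' j.+1.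
    by move=> qj1; apply: (mulrIn (@oner_neq0 R)); apply: Eb; lra.
  have [qje|qje] := eqVneq q.2 j%:R.
    have Ej : lvl u v j = lvl u' v' j by apply: Ea; rewrite qje ltr_nat.
    have q1 : 2 * q.1 = (lvl u v j)%:R by rewrite E qje; ring.
    by apply: (meet j qje _ _ Ej q1); rewrite ?uj ?uj' ltnW.
  have [qje1|qje1] := eqVneq q.2 j.+1%:R.
    have Ej : lvl u v j.+1 = lvl u' v' j.+1 by apply: Eb; rewrite qje1 ltr_nat.
    have q1 : 2 * q.1 = (lvl u v j.+1)%:R by rewrite E qje1 -natr1; ring.
    by apply: (meet _ qje1 _ _ Ej q1); rewrite ?jv ?jv' ltnW.
  (* Strictly inside the strip the levels agree on both boundaries, each time at a common vertex;
     both edges would then join the same two vertices. *)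
  have {}Ea : lvl u v j = lvl u' v' j by apply: Ea; rewrite lt_neqAle qje1.
  have {}Eb : lvl u v j.+1 = lvl u' v' j.+1 by apply: Eb; rewrite lt_neqAle eq_sym qje.
  have c1 : (l u <= j <= l v)%N by rewrite uj ltnW.
  have c1' : (l u' <= j <= l v')%N by rewrite uj' ltnW.
  have c2 : (l u <= j.+1 <= l v)%N by rewrite jv ltnW.
  have c2' : (l u' <= j.+1 <= l v')%N by rewrite jv' ltnW.
  case: (level_eq e_sym tl r r' c1 c1' Ea) => [//|[w [wI lw _]]].
  case: (level_eq e_sym tl r r' c2 c2' Eb) => [//|[w' [wI' lw' _]]].
  case: ne; move: wI wI'; rewrite !inE.
  move=> /andP[wuv wuv'] /andP[w'uv w'uv'].
  have two x y : w \in [set x; y] -> w' \in [set x; y] -> (l x < l y)%N -> (x, y) = (w, w').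
    rewrite !inE => /orP[] /eqP wx /orP[] /eqP w'x; move: lw lw'; rewrite wx w'x //.
    - by move=> -> /n_Sn.
    - by move=> -> ->; rewrite ltnNge leqnSn.
    - by move=> -> /n_Sn.
  by rewrite (two u v) ?(two u' v') ?inE //; [case/and3P: r'|case/and3P: r].
(* At height exactly 1 the two segments may lie in different strips and are compared by [meet]; at
   any other height they share a strip. *)
have [h1|h1] := lerP q.2 1; have [h2|h2] := lerP 1 q.2.
- have E : q.2 = 1%:R by apply/eqP; rewrite eq_le h1.
  rewrite E !ler_nat in uq qv uq' qv'.
  have at1 x y : rise x y -> (l x <= 1 <= l y)%N ->
      (forall j, (l x <= j)%N -> (j < l y)%N ->
      2 * q.1 = (1 - (q.2 - j%:R)) * (lvl x y j)%:R + (q.2 - j%:R) * (lvl x y j.+1)%:R) ->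
      2 * q.1 = (lvl x y 1)%:R.
    move=> /and3P[_ lxy _] /andP[x1 y1] lv; case: (posnP (l x)) => [x0|x0].
      by rewrite (lv 0%N) ?x0 // E; ring.
    by rewrite (lv 1%N) ?(leq_ltn_trans x0) // E; ring.
  have juv : (l u <= 1 <= l v)%N by rewrite uq qv.
  have juv' : (l u' <= 1 <= l v')%N by rewrite uq' qv'.
  have q1 := at1 u v r juv lev.
  apply: (meet 1%N E juv juv' _ q1); apply: (mulrIn (@oner_neq0 R)).
  exact: etrans (esym q1) (at1 u' v' r' juv' lev').
- have lu : l u = 0%N by apply/eqP; rewrite -leqn0 -ltnS -(ltr_nat R); apply: le_lt_trans h2.
  have lu' : l u' = 0%N by apply/eqP; rewrite -leqn0 -ltnS -(ltr_nat R); apply: le_lt_trans h2.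
  have q0 : 0 <= q.2 by rewrite lu in uq.
  by apply: (strip 0%N); rewrite ?lu ?lu' ?q0 //;
     [case/and3P: r; rewrite lu|case/and3P: r'; rewrite lu'].
- have lv : l v = 2%N.
    apply/eqP; rewrite eqn_leq -[(1 < _)%N](ltr_nat R) (lt_le_trans h1) //.
    by case/and3P: r => _ _ ->.
  have lv' : l v' = 2%N.
    apply/eqP; rewrite eqn_leq -[(1 < _)%N](ltr_nat R) (lt_le_trans h1) //.
    by case/and3P: r' => _ _ ->.
  have q2 : q.2 <= 2 by rewrite lv in qv.
  have lu1 : (l u <= 1)%N by case/and3P: r; rewrite lv.
  have lu1' : (l u' <= 1)%N by case/and3P: r'; rewrite lv'.
  by apply: (strip 1%N); rewrite ?lv ?lv' ?lu1 ?lu1' ?q2 ?(ltW h1).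
- by have := lt_trans h1 h2; rewrite ltxx.
Qed.
End Geometry.

(** * Chains of a timeline as the paths of a drawing *)

Section Chains.
Variables (R : realType) (T : finType) (e : rel T).
Hypotheses (e_sym : symmetric e) (e_irr : irreflexive e).
Variables (k N : nat) (c : T -> 'I_k) (s d : T -> nat).
Hypotheses (tl : timeline e N c s d) (surj : forall i, exists v, c v = i).

Definition chain (i : 'I_k) : seq T := sort (relpre s leq) (enum [pred v | c v == i]).

Lemma mem_chain i v : (v \in chain i) = (c v == i).
Proof. by rewrite mem_sort mem_enum. Qed.

Lemma chain_uniq i : uniq (chain i).
Proof. by rewrite sort_uniq enum_uniq. Qed.

Lemma chain_sorted i : sorted (relpre s ltn) (chain i).
Proof.
have le_sorted : sorted (relpre s leq) (chain i).
  by apply: sort_sorted => u v; apply: leq_total.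
rewrite -sorted_map ltn_sorted_uniq_leq sorted_map le_sorted andbT.
rewrite map_inj_in_uniq ?chain_uniq //.
move=> u v; rewrite !mem_chain => /eqP cu /eqP cv; apply: (tl_start_inj tl).
by rewrite cu cv.
Qed.

Lemma chain_index i u v : c u = i -> c v = i ->
  (index u (chain i) < index v (chain i)) = (s u < s v).
Proof.
move=> cu cv; have uc : u \in chain i by rewrite mem_chain cu.
have vc : v \in chain i by rewrite mem_chain cv.
have tr : transitive (relpre s ltn) by move=> x y z; apply: ltn_trans.
have mono a b : a \in chain i -> b \in chain i ->
    index a (chain i) < index b (chain i) -> s a < s b.
  by move=> ac bc; apply: (sorted_ltn_index tr (chain_sorted i)).
case: (ltngtP (index u (chain i)) (index v (chain i))) => [/mono-> //|/mono|].
  by move=> /(_ vc uc); case: ltngtP.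
by move/(index_inj u uc vc) => ->; rewrite ltnn.
Qed.

Lemma chain_index_next i u v : c u = i -> c v = i ->
  ((index u (chain i)).+1 == index v (chain i)) = (d u == s v).
Proof.
move=> cu cv; have cuv : c u = c v by rewrite cu cv.
have vs : index v (chain i) < size (chain i) by rewrite index_mem mem_chain cv.
have lu := tl_lt tl u; have lv := tl_lt tl v.
apply/idP/idP => /eqP E.
  have : s u < s v by rewrite -(chain_index cu cv) -E.
  move=> suv; have uv : u != v by [apply: contraTN suv => /eqP->; rewrite ltnn].
  have duv : d u <= s v by have := tl_disj tl cuv uv; lia.
  rewrite eqn_leq duv leqNgt; apply/negP => duv'.
  have [|w cw sw] := tl_next tl (u := u); first by have := tl_le tl v; lia.
  rewrite cu in cw; have := chain_index cu cw; have := chain_index cw cv; lia.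
have suv : index u (chain i) < index v (chain i) by rewrite (chain_index cu cv) -E.
rewrite eqn_leq suv leqNgt; apply/negP => lt.
pose w := nth u (chain i) (index u (chain i)).+1.
have ws : (index u (chain i)).+1 < size (chain i) by apply: ltn_trans vs.
have iw : index w (chain i) = (index u (chain i)).+1 by rewrite index_uniq ?chain_uniq.
have cw : c w = i by apply/eqP; rewrite -mem_chain mem_nth.
have := chain_index cu cw; have := chain_index cw cv; rewrite iw lt ltnSn => wv uw.
have uw' : u != w by apply/eqP => uw'; rewrite -uw' ltnn in uw.
by have := tl_disj tl (etrans cu (esym cw)) uw'; have := tl_lt tl w; lia.
Qed.

(** Activity intervals in one chain are disjoint, and by [tl_edge] those of adjacent vertices must
    abut, which means being consecutive by [chain_index_next]. *)
Lemma chain_induced i : induced_path e (chain i).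
Proof.
split; [|exact: chain_uniq|].
  by have [v cv] := surj i; apply/eqP => E; have := mem_chain i v; rewrite E cv eqxx.
move=> u v; rewrite !mem_chain => /eqP cu /eqP cv; rewrite !chain_index_next //.
have cuv : c u = c v by rewrite cu cv.
apply/idP/orP => [euv|[]/eqP E]; last 2 first.
- exact: (tl_consec tl).
- by rewrite e_sym; apply: (tl_consec tl).
have [duv|duv] := leqP (d u) (s v).
  by left; have [|_ ->] := tl_edge tl (u := v) (v := u) _ duv; rewrite ?eqxx // e_sym.
have [dvu|dvu] := leqP (d v) (s u).
  by right; have [_ ->] := tl_edge tl euv dvu.
have [E|uv] := eqVneq u v; first by rewrite E e_irr in euv.
by have := tl_disj tl cuv uv; lia.
Qed.

Lemma path_graph_timeline : k = 1 -> path_graph e.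
Proof.
move=> k1; have [v0 _] : exists v : T, True.
  by case: (k) k1 c surj => [//|k'] _ c0 /(_ ord0)[v _]; exists v.
exists (chain (c v0)) => [|v]; first exact: chain_induced.
rewrite mem_chain; apply/eqP/val_inj => /=.
by have := ltn_ord (c v); have := ltn_ord (c v0); lia.
Qed.

Section Drawing.
Variable f : 'I_k -> nat.
Hypotheses (f_inj : injective f) (f2 : forall i, f i <= 2).
Hypothesis cross_nbrs : forall v x x',
  f (c v) = 1 -> e v x -> f (c x) != 1 -> e v x' -> f (c x') != 1 -> s x < d x'.

Local Notation l := (fun v => f (c v)).

Lemma timeline_relabel : timeline e N l s d.
Proof.
constructor; try by case: tl.
- by move=> u /(tl_next tl)[v cv sv]; exists v; rewrite ?cv.
- by move=> u /(tl_prev tl)[v cv sv]; exists v; rewrite ?cv.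
- by move=> u v /f_inj; apply: (tl_disj tl).
- by move=> u v /f_inj; apply: (tl_consec tl).
- by move=> u v euv /(tl_edge tl euv)[-> ->].
Qed.

Lemma chain_standard_drawing :
  standard_drawing e chain (position R e N l s d).
Proof.
have tll := timeline_relabel.
have cross u v : cross_edge e chain u v -> rising e l u v \/ rising e l v u.
  case/andP=> euv /existsPn/(_ (c u)); rewrite !mem_chain eqxx /= => cuv.
  have : f (c v) != f (c u) by rewrite (inj_eq f_inj).
  by rewrite neq_ltn /rising euv e_sym euv !f2 !andbT /= orbC => /orP.
constructor.
- exact: chain_induced.
- by move=> i j v; rewrite !mem_chain => /eqP-> /eqP.
- by move=> v; exists (c v); rewrite mem_chain.
- exists (fun i => (f i)%:R%R); first by move=> i j /eqP; rewrite eqr_nat => /eqP /f_inj.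
  by move=> i v; rewrite mem_chain => /eqP <-.
- move=> i; apply: (sub_in_sorted (P := mem (chain i)) (e := relpre s ltn)).
  + move=> u v; rewrite !mem_chain => /eqP cu /eqP cv suv /=; rewrite ltr_nat.
    by apply: (abscissa_mono e_sym tll) => //; rewrite cu cv.
  + by apply/allP.
  + exact: chain_sorted.
- move=> u v w /cross[] r seg; first exact: (on_segment_vertex e_sym tll r seg).
  by rewrite setUC; apply: (on_segment_vertex e_sym tll r (on_segmentC seg)).
- move=> u v u' v' uv uv' ne q qu qu'.
  have [a [b [r ab qab]]] : exists a b, [/\ rising e l a b, [set a; b] = [set u; v] &
      on_segment q (position R e N l s d a) (position R e N l s d b)].
    case/cross: uv => r; first by exists u, v.
    by exists v, u; split=> //; [rewrite setUC|apply: on_segmentC].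
  have [a' [b' [r' ab' qab']]] : exists a b, [/\ rising e l a b, [set a; b] = [set u'; v'] &
      on_segment q (position R e N l s d a) (position R e N l s d b)].
    case/cross: uv' => r'; first by exists u', v'.
    by exists v', u'; split=> //; [rewrite setUC|apply: on_segmentC].
  rewrite -ab -ab' in ne *.
  apply: (rising_segments e_sym tll cross_nbrs r r') => // -[E1 E2].
  by move: ne; rewrite E1 E2 eqxx.
Qed.

End Drawing.

End Chains.

(** * Forcing along a standard drawing *)

Section StandardDrawing.
Local Open Scope ring_scope.
Variables (R : realType) (T : finType) (e : rel T) (k : nat).
Variables (P : 'I_k -> seq T) (pos : T -> R * R).
Hypothesis sd : standard_drawing e P pos.

Lemma path_uniq i : uniq (P i).
Proof. by have [] := sd_induced sd i. Qed.

Lemma path_index_mono i u v : u \in P i -> v \in P i ->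
  (index u (P i) < index v (P i))%N = ((pos u).1 < (pos v).1).
Proof.
move=> ui vi; have tr : transitive (fun u v => (pos u).1 < (pos v).1).
  by move=> y x z; apply: lt_trans.
have mono a b : a \in P i -> b \in P i -> (index a (P i) < index b (P i))%N ->
    (pos a).1 < (pos b).1.
  by move=> ac bc; apply: (sorted_ltn_index tr (sd_horizontal sd i)).
case: (ltngtP (index u (P i)) (index v (P i))) => [/mono-> //|/mono|].
  by move=> /(_ vi ui) /ltW; rewrite leNgt => /negbTE->.
by move/(index_inj u ui vi) => ->; rewrite ltxx.
Qed.

Lemma cross_edge_paths i j u v : u \in P i -> v \in P j -> i != j -> e u v ->
  cross_edge e P u v.
Proof.
move=> ui vj ij euv; rewrite /cross_edge euv; apply/existsPn => m; apply: contraNN ij.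
by case/andP=> um vm; rewrite (sd_disjoint sd ui um) (sd_disjoint sd vj vm).
Qed.

Lemma paths_neq i j u v : i != j -> u \in P i -> v \in P j -> u != v.
Proof.
move=> ij ui vj; apply: contraNneq ij => uv; rewrite uv in ui.
by rewrite (sd_disjoint sd ui vj).
Qed.

Lemma abscissa_neq u v : (pos u).1 < (pos v).1 -> u != v.
Proof. by apply: contraTneq => ->; rewrite ltxx. Qed.

Lemma disjoint_segments u v u' v' q : cross_edge e P u v -> cross_edge e P u' v' ->
  u \notin [set u'; v'] -> v \notin [set u'; v'] ->
  on_segment q (pos u) (pos v) -> on_segment q (pos u') (pos v') -> False.
Proof.
move=> uv u'v' nu nv qu qu'.
have ne : [set u; v] != [set u'; v'].
  by apply: contraNneq nu => <-; rewrite set21.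
have [w /setIP[/set2P[]-> ww'] _] := sd_noncrossing sd uv u'v' ne qu qu'.
  by rewrite ww' in nu.
by rewrite ww' in nv.
Qed.

(* With a i the index of the last coloured vertex of the i-th path, path i is *)
(* blocked by path j if that vertex has a noncoloured neighbour in path j.    *)
Definition blocked (a : 'I_k -> nat) i j :=
  [exists u, exists w, [&& u \in P i, index u (P i) == a i, w \in P j,
                           (a j < index w (P j))%N & e u w]].

Lemma blockedP a i j : reflect
  (exists u w, [/\ u \in P i, index u (P i) = a i, w \in P j,
                   (a j < index w (P j))%N & e u w])
  (blocked a i j).
Proof.
apply: (iffP existsP) => [[u /existsP[w /and5P[ui /eqP ua wj wa euw]]]|].
  by exists u, w.
move=> [u [w [ui ua wj wa euw]]]; exists u; apply/existsP; exists w.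
by rewrite ui ua wj wa eqxx.
Qed.

(** On each path the last coloured vertex is to the left of the uncoloured one, so the two blocking
    edges reverse their order between the lines and cross. *)
Lemma blocked_pair a i j : i != j -> blocked a i j -> blocked a j i -> False.
Proof.
move=> ij /blockedP[u [w [ui ua wj wa euw]]] /blockedP[u' [w' [u'j ua' w'i wa' euw']]].
have uw' : (pos u).1 < (pos w').1 by rewrite -(path_index_mono ui w'i) ua.
have u'w : (pos u').1 < (pos w).1 by rewrite -(path_index_mono u'j wj) ua'.
have [t t01 E] := crossing_parameter uw' (ltW u'w).
have ji : j != i by rewrite eq_sym.
have [h _ hE] := sd_lines sd.
apply: (@disjoint_segments u w u' w'
    ((1 - t) * (pos u).1 + t * (pos w).1, (1 - t) * h i + t * h j)).
- exact: cross_edge_paths ui wj ij euw.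
- by apply: cross_edge_paths u'j w'i _ euw'; rewrite eq_sym.
- by rewrite !inE negb_or (paths_neq ij) // abscissa_neq.
- by rewrite !inE negb_or eq_sym abscissa_neq //= (paths_neq ji).
- by exists t => //=; rewrite (hE _ _ ui) (hE _ _ wj).
- apply: on_segmentC; exists t => //=; rewrite E (hE _ _ w'i) (hE _ _ u'j) //.
Qed.

Lemma blocked_triple a i j m (h : 'I_k -> R) :
  (forall i v, v \in P i -> (pos v).2 = h i) ->
  i != j -> j != m -> m != i ->
  (h i < h j) && (h j < h m) || (h m < h j) && (h j < h i) ->
  blocked a i j -> blocked a j m -> blocked a m i -> False.
Proof.
move=> hE ij jm mi hij /blockedP[u [w [ui ua wj wa euw]]].
move=> /blockedP[u' [w' [u'j ua' w'm wa' euw']]].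
move=> /blockedP[u'' [w'' [u''m ua'' w''i wa'' euw'']]].
have uw'' : (pos u).1 < (pos w'').1 by rewrite -(path_index_mono ui w''i) ua.
have u'w : (pos u').1 < (pos w).1 by rewrite -(path_index_mono u'j wj) ua'.
have u''w' : (pos u'').1 < (pos w').1 by rewrite -(path_index_mono u''m w'm) ua''.
have ji : j != i by rewrite eq_sym.
have mj : m != j by rewrite eq_sym.
have im : i != m by rewrite eq_sym.
have c1 := cross_edge_paths ui wj ij euw.
have c2 := cross_edge_paths u'j w'm jm euw'.
have c3 := cross_edge_paths u''m w''i mi euw''.
have [l /andP[l0 l1] hj] := between_convex hij.
(* The abscissa at which the edge from [w''] to [u''] meets the line of path [j]. If it is at most
   that of [w], this edge crosses [u w]; otherwise it is beyond [u'] and the edge crosses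
   [u' w']. *)
pose p := (1 - l) * (pos w'').1 + l * (pos u'').1.
have [pw|wp] := lerP p (pos w).1.
- have [t /andP[t0 t1] E] := crossing_parameter uw'' pw.
  apply: (@disjoint_segments u w u'' w''
    ((1 - t) * (pos u).1 + t * (pos w).1, (1 - t) * h i + t * h j)).
  + exact: c1.
  + exact: c3.
  + by rewrite !inE negb_or (paths_neq im) //= abscissa_neq.
  + by rewrite !inE negb_or (paths_neq jm) // (paths_neq ji).
  + by exists t; rewrite ?t0 //= (hE _ _ ui) (hE _ _ wj).
  (* The edge from [w''] reaches the line of path [j] at parameter [l], so the fraction [t] of that
     part is at [t * l]. *)
  + apply: on_segmentC; exists (t * l) => /=; first by apply/andP; split; nra.
    by rewrite E (hE _ _ u''m) (hE _ _ w''i) hj /p; congr pair; ring.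
- have [t /andP[t0 t1] E] := crossing_parameter (lt_trans u'w wp) (ltW u''w').
  apply: (@disjoint_segments u' w' u'' w''
    ((1 - t) * (pos u').1 + t * (pos w').1, (1 - t) * h j + t * h m)).
  + exact: c2.
  + exact: c3.
  + by rewrite !inE negb_or (paths_neq jm) // (paths_neq ji).
  + by rewrite !inE negb_or eq_sym abscissa_neq //= (paths_neq mi).
  + by exists t; rewrite ?t0 //= (hE _ _ u'j) (hE _ _ w'm).
  + apply: on_segmentC; exists (l + t * (1 - l)) => /=; first by apply/andP; split; nra.
    by rewrite E (hE _ _ u''m) (hE _ _ w''i) hj /p; congr pair; ring.
Qed.

(** One of the three lines lies between the other two; rotating the cycle makes it the line of path
    [j] in [blocked_triple]. *)
Lemma blocked_cycle a i j m : i != j -> j != m -> m != i ->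
  blocked a i j -> blocked a j m -> blocked a m i -> False.
Proof.
move=> ij jm mi bij bjm bmi; have [h h_inj hE] := sd_lines sd.
have hij : h i != h j by rewrite (inj_eq h_inj).
have hjm : h j != h m by rewrite (inj_eq h_inj).
have hmi : h m != h i by rewrite (inj_eq h_inj).
have [b|nb1] := boolP ((h i < h j) && (h j < h m) || (h m < h j) && (h j < h i)).
  exact: (blocked_triple hE ij jm mi b bij bjm bmi).
have [b|nb2] := boolP ((h j < h m) && (h m < h i) || (h i < h m) && (h m < h j)).
  exact: (blocked_triple hE jm mi ij b bjm bmi bij).
apply: (blocked_triple hE mi ij jm _ bmi bij bjm); move: nb1 nb2.
by case: (ltgtP (h i) (h j)) hij => // h1 _; case: (ltgtP (h j) (h m)) hjm => // h2 _;
   case: (ltgtP (h m) (h i)) hmi => // h3 _;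
   have := lt_trans h1 h2 => /lt_trans/(_ h3); rewrite ltxx.
Qed.

Local Open Scope nat_scope.

Lemma blocked_unfinished a i j : blocked a i j -> (a j).+1 < size (P j).
Proof.
by case/blockedP=> u [w [_ _ wj wa _]]; apply: leq_ltn_trans wa _; rewrite index_mem.
Qed.

(** A path that blocks another is itself unfinished. Following blocking paths from [i0] without
    cycles of length 2 or 3 would visit four distinct paths. *)
Lemma unblocked_path a i0 : k <= 3 -> (a i0).+1 < size (P i0) ->
  exists2 i, (a i).+1 < size (P i) & forall j, i != j -> ~~ blocked a i j.
Proof.
move=> k3 un0.
have dich i : (exists2 j, i != j & blocked a i j) \/ forall j, i != j -> ~~ blocked a i j.
  have [/existsP[j /andP[ij b]]|nb] := boolP [exists j, (i != j) && blocked a i j].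
    by left; exists j.
  by right=> j ij; apply: contraNN nb => b; apply/existsP; exists j; rewrite ij.
have [[i1 i01 b01]|] := dich i0; last by exists i0.
have [[i2 i12 b12]|] := dich i1; last by exists i1 => //; apply: blocked_unfinished b01.
have [[i3 i23 b23]|] := dich i2; last by exists i2 => //; apply: blocked_unfinished b12.
have i02 : i0 != i2.
  by apply/eqP => E; move: b12; rewrite -E => b; apply: (blocked_pair i01 b01 b).
have i13 : i1 != i3.
  by apply/eqP => E; move: b23; rewrite -E => b; apply: (blocked_pair i12 b12 b).
have [i03|i03] := eqVneq i3 i0.
  by move: i23 b23; rewrite i03 => i20 b20; case: (blocked_cycle i01 i12 i20 b01 b12 b20).
have : uniq [:: i0; i1; i2; i3] by rewrite /= !inE !negb_or i01 i02 i12 i13 i23 eq_sym i03.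
move/card_uniqP => E; have := max_card (mem [:: i0; i1; i2; i3]).
by rewrite E card_ord /=; lia.
Qed.

Definition prefixes (a : 'I_k -> nat) : {set T} :=
  [set v | [exists i, (v \in P i) && (index v (P i) <= a i)]].

Lemma mem_prefixes a i v : v \in P i -> (v \in prefixes a) = (index v (P i) <= a i).
Proof.
move=> vi; rewrite inE; apply/existsP/idP => [[j /andP[vj]]|le_v].
  by rewrite (sd_disjoint sd vi vj).
by exists i; rewrite vi.
Qed.

(** The invariant is that a coloured vertex other than the last one on its path has only coloured
    neighbours. The last coloured vertex of an unblocked unfinished path can force its successor,
    and the invariant persists. *)
Lemma prefixes_forcing a : k <= 3 -> (forall i, a i < size (P i)) ->
  (forall i u w, u \in P i -> index u (P i) < a i -> e u w -> w \in prefixes a) ->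
  forcing_set e (prefixes a).
Proof.
move=> k3; have [n] := ubnP (#|T| - #|prefixes a|); elim: n => // n IHn in a *.
move=> lt_n asz closed.
have [->|] := eqVneq (prefixes a) setT; first exact: forcing_setT.
rewrite -subTset => /subsetPn[v0 _ v0a].
have [i0 v0i] := sd_cover sd v0.
have un0 : (a i0).+1 < size (P i0).
  by move: v0a; rewrite (mem_prefixes a v0i) -ltnNge => /leq_ltn_trans-> //; rewrite index_mem.
have [i un nb] := unblocked_path k3 un0.
pose u := nth v0 (P i) (a i); pose b := nth v0 (P i) (a i).+1.
have ui : u \in P i by rewrite mem_nth.
have bi : b \in P i by rewrite mem_nth.
have iu : index u (P i) = a i by rewrite index_uniq ?path_uniq.
have ib : index b (P i) = (a i).+1 by rewrite index_uniq ?path_uniq.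
have [_ _ ind] := sd_induced sd i.
have ua : u \in prefixes a by rewrite (mem_prefixes a ui) iu.
have ba : b \notin prefixes a by rewrite (mem_prefixes a bi) ib ltnn.
have eub : e u b by rewrite ind // iu ib eqxx.
have Nu : uncolored_nbrs e (prefixes a) u = [set b].
  apply/setP=> w; rewrite [LHS]inE in_set1.
  apply/andP/eqP => [[euw wa]|->//].
  have [j wj] := sd_cover sd w.
  move: wa; rewrite (mem_prefixes a wj) -ltnNge => wa.
  have [ij|ij] := eqVneq i j; last first.
    by case/blockedP: (nb j ij); exists u, w.
  rewrite -ij in wj wa; move: euw; rewrite ind // iu => /orP[/eqP E|/eqP E]; last by lia.
  by rewrite -[w](nth_index v0 wj) -E.
pose a' j := if j == i then (a i).+1 else a j.
have Ea' : prefixes a' = b |: prefixes a.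
  apply/setP=> w; have [j wj] := sd_cover sd w.
  rewrite in_setU1 !(mem_prefixes _ wj) /a'; case: eqP => [ji|/eqP ji].
    rewrite ji in wj *; rewrite leq_eqVlt ltnS; congr orb; apply/eqP/eqP => [E|-> //].
    by rewrite -[w](nth_index v0 wj) E.
  by have [E|//] := eqVneq w b; rewrite E in wj; rewrite (sd_disjoint sd bi wj) eqxx in ji.
apply: (forcing_set_force ua Nu); rewrite -Ea'; apply: IHn.
- have := max_card (mem (b |: prefixes a)); rewrite Ea' cardsU1 ba; lia.
- by move=> j; rewrite /a'; case: eqP => [->|].
- move=> j x w xj; rewrite Ea' /a' in_setU1; case: eqP => [ji|_ xa exw]; last first.
    by rewrite (closed j x) ?orbT.
  rewrite ji in xj *; rewrite ltnS leq_eqVlt => /orP[/eqP E|xa] exw; last first.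
    by rewrite (closed i x) ?orbT.
  have xu : x = u by rewrite -[x](nth_index v0 xj) E.
  have [//|wb] := eqVneq w b; apply: contraTT exw => wa; rewrite xu.
  apply: contraNN wb => euw.
  have : w \in uncolored_nbrs e (prefixes a) u by rewrite /uncolored_nbrs in_set euw.
  by rewrite Nu in_set1.
Qed.

Lemma leftmost_verticesE : leftmost_vertices P pos = prefixes (fun=> 0).
Proof.
apply/setP=> v; rewrite !inE; apply: eq_existsb => i; apply: andb_id2l => vi.
apply/allP/idP => [min|v0 w wi]; last first.
  by rewrite leNgt -(path_index_mono wi vi) -leqNgt (leq_trans v0).
have sz : 0 < size (P i) by rewrite -has_predT; apply/hasP; exists v.
have w0 : nth v (P i) 0 \in P i by rewrite mem_nth.
by have := min _ w0; rewrite leNgt -(path_index_mono w0 vi) index_uniq ?path_uniq // -leqNgt.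
Qed.

Lemma leftmost_vertices_forcing : k <= 3 -> forcing_set e (leftmost_vertices P pos).
Proof.
move=> k3; rewrite leftmost_verticesE; apply: prefixes_forcing => // i.
by have [] := sd_induced sd i; case: (P i).
Qed.

Lemma card_leftmost_vertices : #|leftmost_vertices P pos| = k.
Proof.
have hd i : exists v, (v \in P i) && (index v (P i) == 0).
  by have [] := sd_induced sd i; case: (P i) => // v p _ _ _; exists v; rewrite /= inE !eqxx.
pose f i := xchoose (hd i).
have fP i : (f i \in P i) && (index (f i) (P i) == 0) := xchooseP (hd i).
have -> : leftmost_vertices P pos = [set f i | i in 'I_k].
  rewrite leftmost_verticesE; apply/setP=> v; apply/idP/imsetP => [|[i _ ->]].
    rewrite inE => /existsP[i /andP[vi v0]]; exists i => //.
    have /andP[fi /eqP f0] := fP i; apply: (index_inj v vi fi).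
    by rewrite f0; apply/eqP; rewrite -leqn0.
  by have /andP[fi /eqP f0] := fP i; rewrite (mem_prefixes _ fi) f0.
rewrite card_imset ?card_ord // => i j E.
have /andP[fi _] := fP i; have /andP[fj _] := fP j; rewrite E in fi.
exact: (sd_disjoint sd fi fj).
Qed.

End StandardDrawing.

(** * From forcing numbers to drawings and back *)

Section ForcingDrawing.
Variables (R : realType) (T : finType) (e : rel T).
Hypotheses (e_sym : symmetric e) (e_irr : irreflexive e).

Lemma path_graph_drawing : path_graph e -> has_standard_drawing R e 1.
Proof.
case=> p [p0 up ind] pT; exists (fun=> p), (fun v => ((index v p)%:R, 0)%R).
have nocross u v : cross_edge e (fun _ : 'I_1 => p) u v = false.
  by apply/negP => /andP[_ /existsPn/(_ ord0)]; rewrite !pT.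
constructor=> //.
- by move=> i j v _ _; rewrite !ord1.
- by move=> v; exists ord0.
- by exists (fun=> 0%R) => // i j _; rewrite !ord1.
- move=> _; have [x0 _] : exists x, x \in p by case: (p) p0 => // x q; exists x; rewrite mem_head.
  apply/(sortedP x0) => i isz.
  change ((index (nth x0 p i) p)%:R < (index (nth x0 p i.+1) p)%:R :> R)%R.
  by rewrite ltr_nat !index_uniq // ltnW.
- by move=> u v w; rewrite nocross.
- by move=> u v u' v'; rewrite nocross.
Qed.

Lemma forcing_set1_path_graph F : forcing_set e F -> #|F| = 1 -> path_graph e.
Proof.
move=> fF cF; have [N [c [s [d [tl surj]]]]] := forcing_set_timeline e_sym e_irr fF cF.
exact: (path_graph_timeline e_sym e_irr tl surj).
Qed.

Lemma forcing_set2_drawing F : forcing_set e F -> #|F| = 2 -> has_standard_drawing R e 2.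
Proof.
move=> fF cF; have [N [c [s [d [tl surj]]]]] := forcing_set_timeline e_sym e_irr fF cF.
(* Heights 0 and 2 leave the middle line empty, so the condition on its vertices is vacuous. *)
pose f (i : 'I_2) := (val i).*2.
have f_inj : injective f by move=> i j /double_inj/val_inj.
have f2 i : f i <= 2 by rewrite /f (leq_double _ 1) -ltnS ltn_ord.
have f1 i : f i = 1 -> False by move=> /(congr1 odd); rewrite odd_double.
exists (chain c s), (position R e N (fun v => f (c v)) s d).
by apply: chain_standard_drawing => //; move=> v x x' /f1.
Qed.

Lemma forcing_set3_drawing F : max_degree e <= 3 ->
  forcing_set e F -> #|F| = 3 -> has_standard_drawing R e 3.
Proof.
move=> deg3 fF cF; have [N [c [s [d [tl surj]]]]] := forcing_set_timeline e_sym e_irr fF cF.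
pose m : 'I_3 := inord 1; have m1 : val m = 1 by rewrite /= inordK.
have [{}c [{}s [{}d [{}tl {}surj ends]]]] := timeline_maximal e_sym m tl surj.
exists (chain c s), (position R e N (fun v => val (c v)) s d).
apply: chain_standard_drawing => //; [exact: val_inj|by move=> i; rewrite -ltnS ltn_ord|].
have cm v : (val (c v) == 1) = (c v == m) by rewrite -(inj_eq val_inj) m1.
move=> v x x' /eqP cv evx cx evx' cx'; rewrite cm in cv; rewrite cm in cx; rewrite cm in cx'.
exact: (timeline_cross_nbrs e_sym deg3 tl ends (eqP cv) evx cx evx' cx').
Qed.

Lemma drawing_forcing_number k : k <= 3 -> has_standard_drawing R e k -> forcing_number e <= k.
Proof.
move=> k3 [P [pos sd]]; rewrite -(card_leftmost_vertices sd).
by apply: (forcing_numberP e).2; apply: leftmost_vertices_forcing.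
Qed.

Lemma drawing_forcing_number_gt0 k : 0 < k -> has_standard_drawing R e k -> 0 < forcing_number e.
Proof.
case: k => // k _ [P [pos sd]]; rewrite lt0n; apply/eqP => f0.
have [[F fF cF] _] := forcing_numberP e.
rewrite f0 in cF; move: fF; rewrite (cards0_eq cF) => /forcing_set0 T0.
have [] := sd_induced sd ord0; case: (P ord0) => // v p _ _ _.
by have := max_card (pred1 v); rewrite card1 T0.
Qed.

End ForcingDrawing.

Theorem theorem3 (R : realType) (T : finType) (e : rel T)
    (e_sym : symmetric e) (e_irr : irreflexive e)
    (max_deg3 : max_degree e <= 3) :
  (forcing_number e = 3 <-> graph_of_parallel_paths R e 3) /\
  (graph_of_parallel_paths R e 3 ->
   forall (P : 'I_3 -> seq T) (pos : T -> R * R),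
     standard_drawing e P pos ->
     forcing_set e (leftmost_vertices P pos) /\
     #|leftmost_vertices P pos| = forcing_number e).
Proof.
have [[F fF cF] _] := forcing_numberP e.
have iff3 : forcing_number e = 3 <-> graph_of_parallel_paths R e 3.
  rewrite graph_of_parallel_pathsE //; split=> [f3|[fewer sd3]].
    split; last by apply: (forcing_set3_drawing R e_sym e_irr max_deg3 fF); rewrite cF.
    (* A drawing on one or two lines would bound the forcing number by 1 or 2. *)
    move=> [|[|[|j]]] // _ Gj.
      by have := drawing_forcing_number (k := 1) isT (path_graph_drawing R Gj); rewrite f3.
    by have := drawing_forcing_number (k := 2) isT Gj.2; rewrite f3.
  have f_le3 := drawing_forcing_number (k := 3) isT sd3.
  have f_gt0 := drawing_forcing_number_gt0 (k := 3) isT sd3.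
  have np : ~ path_graph e by apply: (fewer 1).
  have f_neq1 : forcing_number e <> 1.
    by move=> f1; apply: np; apply: (forcing_set1_path_graph e_sym e_irr fF); rewrite cF.
  have f_neq2 : forcing_number e <> 2.
    move=> f2; apply: (fewer 2) => //; split; first by case=> [[]|].
    by apply: (forcing_set2_drawing R e_sym e_irr fF); rewrite cF.
  lia.
split=> // G3 P pos sd; split; first exact: leftmost_vertices_forcing.
by rewrite (card_leftmost_vertices sd); apply/esym/iff3.
Qed.
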